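(* Let $1<p<\infty$, let $h\in H^p(\mathbb{D})$ and let $\psi:\mathbb{D}\to\mathbb{D}$ be holomorphic such that the weighted composition operator $W_{h,\psi}f(z)=h(z)f(\psi(z))$ is bounded on $H^p(\mathbb{D})$. For $\lambda\in\mathbb{D}$ let $k_\lambda(z)=1/(1-\overline{\lambda}z)$. The following are equivalent: (i) $W_{h,\psi}$ is bounded below on $H^p$, i.e. there is $\delta>0$ with $\|W_{h,\psi}f\|_p\ge\delta\|f\|_p$ for all $f\in H^p$; (ii) there exists $C>0$ such that $\|W_{h,\psi}k_\lambda\|_p\ge C\|k_\lambda\|_p$ for all $\lambda\in\mathbb{D}$.
   Context: $\mathbb{D}$ is the open unit disc and $H^p(\mathbb{D})$ the Hardy space with its usual norm $\|\cdot\|_p$. *)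

(* Defs.v *)
From Stdlib Require Import Reals.
From Coquelicot Require Import Coquelicot.
Open Scope R_scope.

Definition inD (z : C) : Prop := Cmod z < 1.

Definition holo_D (f : C -> C) : Prop :=
  forall z : C, inD z -> exists l : C, @is_derive C_AbsRing C_NormedModule f z l.

(* x^a for x >= 0, with the convention 0^a = 0 (a > 0) *)
Definition rpow (x a : R) : R :=
  if Req_EM_T x 0 then 0 else Rpower x a.

Definition circ (r t : R) : C := (r * cos t, r * sin t).

Definition Mp (p : R) (f : C -> C) (r : R) : R :=
  RInt (fun t => rpow (Cmod (f (circ r t))) p) 0 (2 * PI) / (2 * PI).

Definition Hp_sup (p : R) (f : C -> C) : Rbar :=
  Lub_Rbar (fun y => exists r : R, 0 <= r < 1 /\ y = rpow (Mp p f r) (1 / p)).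

Definition in_Hp (p : R) (f : C -> C) : Prop :=
  holo_D f /\ is_finite (Hp_sup p f).

Definition Hp_norm (p : R) (f : C -> C) : R := real (Hp_sup p f).

Definition Wcomp (h psi : C -> C) (f : C -> C) : C -> C :=
  fun z => Cmult (h z) (f (psi z)).

Definition kernel (lam : C) : C -> C :=
  fun z => Cinv (Cminus (RtoC 1) (Cmult (Cconj lam) z)).

Definition Wbounded (p : R) (h psi : C -> C) : Prop :=
  (forall f, in_Hp p f -> in_Hp p (Wcomp h psi f)) /\
  exists M : R, forall f, in_Hp p f ->
    Hp_norm p (Wcomp h psi f) <= M * Hp_norm p f.

(* Main.v *)
Require Import Defs.
From Stdlib Require Import Reals Lra Lia Classical ClassicalEpsilon.
From Coquelicot Require Import Coquelicot.
Open Scope R_scope.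

(** (ii) => (i).  Put lambda_j = (1 - 1/N) w^j with w a primitive N-th root of unity.  For
    f continuous on the closed disc the function
    N^{-p} * sum_j |f(w^j)|^p |k_{lambda_j}(z)|^p is bounded on the disc by
    c |f(z)|^p + o(1), because the normalised kernels concentrate near w^j and their sum is
    bounded.  Integrating against |h|^p at z = psi(r e^{it}) and bounding each
    ||W k_{lambda_j}|| from below by (ii) gives (1/N) sum_j |f(w^j)|^p <= A ||W f||^p + o(1),
    and the left side tends to the mean of |f|^p.  A general f is replaced by its dilations
    f(rho z), which converge to f in H^p: this follows from the uniform convexity of |.|^p
    together with the monotonicity in r of the integral means, so no boundary values are
    needed.  Monotonicity is the maximum principle for |f|^p, and rests on Goursat's
    bisection argument since holomorphy is plain pointwise differentiability. *)

(** * Powers and tangent inequalities *)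

(** From (i) to (ii) it suffices that every kernel lies in H^p. In the converse, the weight N^{-p}
    comes from the size of the kernels: ||k_{lambda_j}||^p is at least a constant times N^{p-1}, so
    (ii) becomes a lower bound with exactly the factor 1/N of a Riemann sum. The assumption p > 1
    enters through the convergence of sum k^{-p}, which bounds the kernel sum by c N^p, and through
    N^{1-p} -> 0, which kills the nodes far from the evaluation point. Both errors are integrated
    against |h|^p and are absorbed because h is in H^p. An obstacle is that a pointwise inequality
    can be integrated over one circle only, whereas each norm in (ii) is a supremum over circles;
    since the means increase with r, one radius serves all N kernels. The resulting constant A does
    not depend on the dilation parameter, and the norm bound on W controls ||W(f - f_rho)|| by ||f -
    f_rho||, so that rho can tend to 1. *)

Lemma rpow_0 a : rpow 0 a = 0.
Proof. unfold rpow; destruct (Req_EM_T 0 0); [reflexivity | lra]. Qed.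

Lemma rpow_pos x a : 0 < x -> rpow x a = Rpower x a.
Proof. intros Hx; unfold rpow; destruct (Req_EM_T x 0); [lra | reflexivity]. Qed.

Lemma rpow_gt_0 x a : 0 < x -> 0 < rpow x a.
Proof. intros Hx; rewrite rpow_pos by assumption; apply exp_pos. Qed.

Lemma rpow_ge_0 x a : 0 <= rpow x a.
Proof.
  unfold rpow; destruct (Req_EM_T x 0); [lra | left; apply exp_pos].
Qed.

Lemma rpow_1 a : rpow 1 a = 1.
Proof.
  rewrite rpow_pos by lra. unfold Rpower. rewrite ln_1, Rmult_0_r. apply exp_0.
Qed.

Lemma rpow_mult x y a : 0 <= x -> 0 <= y -> rpow (x * y) a = rpow x a * rpow y a.
Proof.
  intros [Hx | <-] [Hy | <-]; rewrite ?Rmult_0_l, ?Rmult_0_r, ?rpow_0; try ring.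
  rewrite !rpow_pos by (try apply Rmult_lt_0_compat; assumption).
  symmetry; apply Rpower_mult_distr; assumption.
Qed.

Lemma rpow_plus x a b : 0 < x -> rpow x (a + b) = rpow x a * rpow x b.
Proof. intros Hx; rewrite !rpow_pos by assumption; apply Rpower_plus. Qed.

Lemma rpow_1_r x : 0 <= x -> rpow x 1 = x.
Proof.
  intros [Hx | <-]; [rewrite rpow_pos, Rpower_1 by assumption | rewrite rpow_0]; reflexivity.
Qed.

Lemma rpow_inv x a : 0 < x -> rpow (/ x) a = / rpow x a.
Proof.
  intros Hx.
  assert (Hi : 0 < / x) by now apply Rinv_0_lt_compat.
  pose proof (rpow_gt_0 x a Hx).
  apply (Rmult_eq_reg_l (rpow x a)); [|lra].
  rewrite <- rpow_mult, Rinv_r, rpow_1 by lra. field; lra.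
Qed.

Lemma rpow_rpow x a b : 0 <= x -> rpow (rpow x a) b = rpow x (a * b).
Proof.
  intros [Hx | <-]; [|now rewrite !rpow_0].
  pose proof (rpow_gt_0 x a Hx).
  rewrite (rpow_pos _ b), !rpow_pos by assumption. apply Rpower_mult.
Qed.

Lemma rpow_root x a : 0 <= x -> a <> 0 -> rpow (rpow x a) (1 / a) = x.
Proof.
  intros Hx Ha. rewrite rpow_rpow by assumption.
  replace (a * (1 / a)) with 1 by (field; assumption). now apply rpow_1_r.
Qed.

Lemma root_rpow x a : 0 <= x -> a <> 0 -> rpow (rpow x (1 / a)) a = x.
Proof.
  intros Hx Ha. rewrite rpow_rpow by assumption.
  replace (1 / a * a) with 1 by (field; assumption). now apply rpow_1_r.
Qed.

Lemma rpow_lt x y a : 0 < a -> 0 <= x < y -> rpow x a < rpow y a.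
Proof.
  intros Ha [[Hx | <-] Hy].
  - rewrite !rpow_pos by lra. apply exp_increasing, Rmult_lt_compat_l; [assumption|].
    now apply ln_increasing.
  - rewrite rpow_0. now apply rpow_gt_0.
Qed.

Lemma rpow_le x y a : 0 < a -> 0 <= x <= y -> rpow x a <= rpow y a.
Proof.
  intros Ha [Hx [Hy | <-]]; [|lra]. left; apply rpow_lt; lra.
Qed.

Lemma rpow_continuous a x : 0 < a -> 0 <= x ->
  forall eps, 0 < eps -> exists d, 0 < d /\
    forall y, 0 <= y -> Rabs (y - x) < d -> Rabs (rpow y a - rpow x a) < eps.
Proof.
  intros Ha [Hx | <-] eps He.
  - assert (Hc : continuity_pt (fun t => Rpower t a) x).
    { apply derivable_continuous_pt. eexists. apply derivable_pt_lim_power, Hx. }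
    destruct (Hc eps He) as [d [Hd Hc']].
    exists (Rmin d (x / 2)); split; [apply Rmin_pos; lra|].
    intros y Hy0 Hy.
    assert (Hy1 := Rlt_le_trans _ _ _ Hy (Rmin_l _ _)).
    assert (Hy2 := Rlt_le_trans _ _ _ Hy (Rmin_r _ _)).
    apply Rabs_def2 in Hy2.
    rewrite !rpow_pos by lra.
    destruct (Req_dec y x) as [-> | Hn]; [rewrite Rminus_diag, Rabs_R0; lra|].
    apply (Hc' y). split; [split; [exact I | auto] | exact Hy1].
  - exists (rpow eps (1 / a)); split; [now apply rpow_gt_0|].
    intros y Hy Hd. rewrite Rminus_0_r in Hd.
    rewrite rpow_0, Rminus_0_r, Rabs_pos_eq by apply rpow_ge_0.
    rewrite Rabs_pos_eq in Hd by assumption.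
    rewrite <- (root_rpow eps a) by lra.
    now apply rpow_lt.
Qed.

Lemma ln_lt_linear x : 0 < x -> x <> 1 -> ln x < x - 1.
Proof.
  intros Hx Hn.
  assert (Hl : ln x <> 0).
  { rewrite <- ln_1. intros E. apply ln_inv in E; lra. }
  pose proof (exp_ineq1 _ Hl) as H. rewrite exp_ln in H by assumption. lra.
Qed.

Lemma ln_le_linear x : 0 < x -> ln x <= x - 1.
Proof.
  intros Hx. destruct (Req_dec x 1) as [-> | Hn]; [rewrite ln_1; lra|].
  left; now apply ln_lt_linear.
Qed.

(* Weighted arithmetic-geometric mean: with [m = t^p / p + 1 - 1 / p], average the bounds
   [ln (t^p / m) <= t^p / m - 1] and [ln (1 / m) < 1 / m - 1] to get [ln t < ln m]. *)
Lemma bernoulli_lt t p : 1 < p -> 0 <= t -> t <> 1 -> 1 + p * (t - 1) < rpow t p.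
Proof.
  intros Hp [Ht | <-] Hn; [|rewrite rpow_0; lra].
  set (s := rpow t p). assert (Hs : 0 < s) by now apply rpow_gt_0.
  set (m := s / p + 1 - 1 / p).
  assert (Hip : 0 < 1 / p < 1).
  { split; [apply Rdiv_lt_0_compat; lra|]. apply Rlt_div_l; lra. }
  assert (Hm : 0 < m).
  { unfold m. assert (0 < s / p) by (apply Rdiv_lt_0_compat; lra). lra. }
  assert (Hlns : ln s = p * ln t).
  { unfold s. rewrite rpow_pos by assumption. apply ln_exp. }
  assert (Hs1 : s <> 1).
  { intros E. rewrite E, ln_1 in Hlns.
    assert (ln t = 0) by nra. rewrite <- ln_1 in H. apply ln_inv in H; lra. }
  assert (Hm1 : / m <> 1).
  { intros E. assert (m = 1) by (rewrite <- (Rinv_inv m), E; apply Rinv_1).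
    unfold m in H. apply Hs1. replace s with (s / p * p) by (field; lra).
    replace (s / p) with (1 / p) by lra. field; lra. }
  assert (H1 : ln (s * / m) <= s * / m - 1).
  { apply ln_le_linear, Rmult_lt_0_compat; [lra | now apply Rinv_0_lt_compat]. }
  assert (H2 : ln (/ m) < / m - 1).
  { apply ln_lt_linear; [now apply Rinv_0_lt_compat | assumption]. }
  rewrite ln_mult in H1 by (try apply Rinv_0_lt_compat; lra).
  rewrite ln_Rinv in H1, H2 by assumption.
  rewrite Hlns in H1.
  assert (H3 : ln t < ln m).
  { assert (E : 1 / p * (s * / m - 1) + (1 - 1 / p) * (/ m - 1) = 0).
    { unfold m; field. fold m. split; [|lra]. unfold m in Hm.
      intros E. assert (s + p * 1 - 1 = p * m) by (unfold m; field; lra).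
      assert (0 < p * m) by (apply Rmult_lt_0_compat; lra). lra. }
    assert (E2 : 1 / p * (p * ln t + - ln m) + (1 - 1 / p) * (- ln m) = ln t - ln m)
      by (field; lra).
    nra. }
  apply ln_lt_inv in H3; [|assumption..].
  assert (p * t < p * m) by (apply Rmult_lt_compat_l; lra).
  assert (p * m = s + p - 1) by (unfold m; field; lra). lra.
Qed.

(** Bernoulli's inequality at [t = y / x], multiplied by [x^p]. *)
Lemma rpow_tangent_lt p x y : 1 < p -> 0 < x -> 0 <= y -> y <> x ->
  rpow x p + p * rpow x (p - 1) * (y - x) < rpow y p.
Proof.
  intros Hp Hx Hy Hn.
  assert (Ht : 0 <= y / x) by (apply Rdiv_le_0_compat; lra).
  assert (Hn' : y / x <> 1).
  { intros E. apply Hn. replace y with (y / x * x) by (field; lra). rewrite E; ring. }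
  pose proof (bernoulli_lt _ p Hp Ht Hn') as H.
  pose proof (rpow_gt_0 x (p - 1) Hx) as Hq.
  assert (E : rpow x p = x * rpow x (p - 1)).
  { rewrite <- (rpow_1_r x) at 2 by lra. rewrite <- rpow_plus by assumption. f_equal; ring. }
  replace (rpow y p) with (rpow x p * rpow (y / x) p).
  2: { rewrite <- rpow_mult by lra. f_equal; field; lra. }
  rewrite E.
  apply Rle_lt_trans with (x * rpow x (p - 1) * (1 + p * (y / x - 1))).
  - right. field; lra.
  - apply Rmult_lt_compat_l; [nra | lra].
Qed.

Lemma rpow_tangent p x y : 1 < p -> 0 < x -> 0 <= y ->
  rpow x p + p * rpow x (p - 1) * (y - x) <= rpow y p.
Proof.
  intros Hp Hx Hy. destruct (Req_dec y x) as [-> | Hn]; [lra|].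
  left; now apply rpow_tangent_lt.
Qed.

Lemma Cmod_sqr (z : C) : Cmod z * Cmod z = fst z * fst z + snd z * snd z.
Proof.
  unfold Cmod. rewrite sqrt_sqrt; [simpl; ring|]. nra.
Qed.

Lemma fst_Cmult_conj_le (a w : C) : fst (Cconj a * w)%C <= Cmod a * Cmod w.
Proof.
  eapply Rle_trans; [apply Rle_abs|]. rewrite <- (Cmod_conj a), <- Cmod_mult.
  eapply Rle_trans; [|apply Rmax_Cmod]. apply Rmax_l.
Qed.

(** Strict convexity of [|.|^p] on the plane, whose gradient at [a] is [p |a|^(p-2) a]; the real
    part of [Cconj a * (w - a)] is the Euclidean inner product. If the moduli differ, strictness
    comes from the scalar tangent inequality; if they agree, from the Cauchy-Schwarz inequality
    being strict for distinct vectors of equal length. At [a = 0] the convention [rpow 0 _ = 0]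
    makes the linear term vanish even when [p - 2] is negative. *)
Lemma Cmod_tangent_lt p (a w : C) : 1 < p -> w <> a ->
  rpow (Cmod a) p + p * rpow (Cmod a) (p - 2) * fst (Cconj a * (w - a))%C < rpow (Cmod w) p.
Proof.
  intros Hp Hn.
  destruct (classic (a = 0%C)) as [-> | Ha].
  { rewrite Cmod_0, !rpow_0.
    assert (0 < rpow (Cmod w) p) by now apply rpow_gt_0, Cmod_gt_0.
    simpl; lra. }
  assert (Ha' : 0 < Cmod a) by now apply Cmod_gt_0.
  pose proof (rpow_gt_0 (Cmod a) (p - 2) Ha') as Hc.
  assert (E : rpow (Cmod a) (p - 1) = rpow (Cmod a) (p - 2) * Cmod a).
  { replace (p - 1) with ((p - 2) + 1) by ring.
    rewrite rpow_plus, (rpow_1_r (Cmod a)) by lra. reflexivity. }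
  assert (E2 : fst (Cconj a * (w - a))%C = fst (Cconj a * w)%C - Cmod a * Cmod a).
  { rewrite Cmod_sqr. simpl. ring. }
  rewrite E2.
  pose proof (fst_Cmult_conj_le a w) as Hcs.
  destruct (Req_dec (Cmod w) (Cmod a)) as [Em | Hm].
  - rewrite Em.
    enough (fst (Cconj a * w)%C < Cmod a * Cmod a).
    { assert (0 < p * rpow (Cmod a) (p - 2)) by (apply Rmult_lt_0_compat; lra). nra. }
    assert (Hd : 0 < Cmod (w - a)).
    { apply Cmod_gt_0. intros E0. apply Hn. replace w with (w - a + a)%C by ring.
      rewrite E0; ring. }
    assert (Hd2 : 0 < Cmod (w - a) * Cmod (w - a)) by nra.
    rewrite Cmod_sqr in Hd2. pose proof (Cmod_sqr w) as Hw. pose proof (Cmod_sqr a) as Hs.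
    rewrite Em in Hw. simpl in *. nra.
  - pose proof (rpow_tangent_lt p (Cmod a) (Cmod w) Hp Ha' (Cmod_ge_0 w) Hm) as Ht.
    rewrite E in Ht.
    eapply Rle_lt_trans; [|exact Ht].
    apply Rplus_le_compat_l. rewrite !Rmult_assoc.
    apply Rmult_le_compat_l; [lra|]. apply Rmult_le_compat_l; [lra|]. nra.
Qed.

Lemma Cmod_tangent p (a w : C) : 1 < p ->
  rpow (Cmod a) p + p * rpow (Cmod a) (p - 2) * fst (Cconj a * (w - a))%C <= rpow (Cmod w) p.
Proof.
  intros Hp. destruct (classic (w = a)) as [-> | Hn].
  - right. replace (Cconj a * (a - a))%C with (RtoC 0) by ring. simpl; ring.
  - left; now apply Cmod_tangent_lt.
Qed.

(** * Continuity and compactness on closed discs *)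

(** An error bound [e] that tends to 0 at [z] relative to [D]. Complex and real continuity are both
    instances, so the rules for sums and products are proved once, for errors. *)
Definition vanishes (D : C -> Prop) (e : C -> R) (z : C) : Prop :=
  forall eps, 0 < eps -> exists d, 0 < d /\
    forall w, D w -> Cmod (w - z) < d -> e w < eps.

Definition ccont (D : C -> Prop) (f : C -> C) (z : C) : Prop :=
  vanishes D (fun w => Cmod (f w - f z)) z.

Definition rcont (D : C -> Prop) (u : C -> R) (z : C) : Prop :=
  vanishes D (fun w => Rabs (u w - u z)) z.

Definition cdisc (r : R) (z : C) : Prop := Cmod z <= r.

Lemma vanishes_le D e e' z :
  (forall w, D w -> e w <= e' w) -> vanishes D e' z -> vanishes D e z.
Proof.
  intros H He eps Heps. destruct (He eps Heps) as [d [Hd Hd']].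
  exists d; split; [assumption|]. intros w Hw Hwz.
  eapply Rle_lt_trans; [now apply H | now apply Hd'].
Qed.

Lemma vanishes_plus D e e' z :
  vanishes D e z -> vanishes D e' z -> vanishes D (fun w => e w + e' w) z.
Proof.
  intros H H' eps Heps.
  destruct (H (eps / 2)) as [d [Hd Hd']]; [lra|].
  destruct (H' (eps / 2)) as [d2 [Hd2 Hd2']]; [lra|].
  exists (Rmin d d2); split; [now apply Rmin_pos|].
  intros w Hw Hwz.
  specialize (Hd' w Hw (Rlt_le_trans _ _ _ Hwz (Rmin_l _ _))).
  specialize (Hd2' w Hw (Rlt_le_trans _ _ _ Hwz (Rmin_r _ _))). lra.
Qed.

Lemma vanishes_scal D e z c : 0 <= c -> vanishes D e z -> vanishes D (fun w => c * e w) z.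
Proof.
  intros Hc H eps Heps.
  destruct (H (eps / (c + 1))) as [d [Hd Hd']]; [apply Rdiv_lt_0_compat; lra|].
  exists d; split; [assumption|]. intros w Hw Hwz.
  specialize (Hd' w Hw Hwz). apply Rlt_div_r in Hd'; [|lra].
  destruct (Rle_dec (e w) 0); nra.
Qed.

Lemma vanishes_mult D e e' z :
  (forall w, 0 <= e w) -> (forall w, 0 <= e' w) ->
  vanishes D e z -> vanishes D e' z -> vanishes D (fun w => e w * e' w) z.
Proof.
  intros P P' H H' eps Heps.
  destruct (H eps Heps) as [d [Hd Hd']].
  destruct (H' 1 Rlt_0_1) as [d2 [Hd2 Hd2']].
  exists (Rmin d d2); split; [now apply Rmin_pos|].
  intros w Hw Hwz.
  specialize (Hd' w Hw (Rlt_le_trans _ _ _ Hwz (Rmin_l _ _))).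
  specialize (Hd2' w Hw (Rlt_le_trans _ _ _ Hwz (Rmin_r _ _))).
  specialize (P w); specialize (P' w). nra.
Qed.

Lemma vanishes_subset (D D' : C -> Prop) e z :
  (forall w, D' w -> D w) -> vanishes D e z -> vanishes D' e z.
Proof.
  intros S H eps Heps. destruct (H eps Heps) as [d [Hd Hd']].
  exists d; split; [assumption|]. intros w Hw. apply Hd'. now apply S.
Qed.

Lemma Cmod_0_sub (z : C) : Cmod (z - z) = 0.
Proof. replace (z - z)%C with (RtoC 0) by ring. apply Cmod_0. Qed.

Lemma Cmod_sub_sym (z w : C) : Cmod (z - w) = Cmod (w - z).
Proof. rewrite <- Cmod_opp. f_equal; ring. Qed.

Lemma Cmod_le_sub (z w : C) : Cmod z <= Cmod w + Cmod (z - w).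
Proof.
  replace z with (w + (z - w))%C at 1 by ring. apply Cmod_triangle.
Qed.

Lemma Cmod_sub_le (z w : C) : Cmod (z - w) <= Cmod z + Cmod w.
Proof. rewrite <- (Cmod_opp w). apply Cmod_triangle. Qed.

Lemma Rabs_Cmod_sub (z w : C) : Rabs (Cmod z - Cmod w) <= Cmod (z - w).
Proof.
  apply Rabs_le. pose proof (Cmod_le_sub z w). pose proof (Cmod_le_sub w z).
  rewrite (Cmod_sub_sym w z) in H0. lra.
Qed.

Lemma ccont_const D c z : ccont D (fun _ => c) z.
Proof.
  intros eps He. exists 1; split; [lra|]. intros. now rewrite Cmod_0_sub.
Qed.

Lemma ccont_id D z : ccont D (fun w => w) z.
Proof. intros eps He. exists eps; split; auto. Qed.

Lemma ccont_plus D f g z :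
  ccont D f z -> ccont D g z -> ccont D (fun w => (f w + g w)%C) z.
Proof.
  intros Hf Hg. eapply vanishes_le; [|exact (vanishes_plus _ _ _ _ Hf Hg)].
  intros w _. cbv beta.
  replace (f w + g w - (f z + g z))%C with ((f w - f z) + (g w - g z))%C by ring.
  apply Cmod_triangle.
Qed.

Lemma ccont_mult D f g z :
  ccont D f z -> ccont D g z -> ccont D (fun w => (f w * g w)%C) z.
Proof.
  intros Hf Hg.
  apply vanishes_le with (fun w => Cmod (f w - f z) * Cmod (g w - g z)
     + (Cmod (g z) * Cmod (f w - f z) + Cmod (f z) * Cmod (g w - g z))).
  - intros w _.
    replace (f w * g w - f z * g z)%C
      with ((f w - f z) * (g w - g z) + (g z * (f w - f z) + f z * (g w - g z)))%C by ring.
    rewrite <- !Cmod_mult.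
    eapply Rle_trans; [apply Cmod_triangle|]. apply Rplus_le_compat_l, Cmod_triangle.
  - apply vanishes_plus; [|apply vanishes_plus; apply vanishes_scal];
      auto using Cmod_ge_0, vanishes_mult.
Qed.

Lemma ccont_comp D D' f g z :
  (forall w, D w -> D' (g w)) -> ccont D g z -> ccont D' f (g z) -> ccont D (fun w => f (g w)) z.
Proof.
  intros S Hg Hf eps He.
  destruct (Hf eps He) as [d [Hd Hd']]. destruct (Hg d Hd) as [d2 [Hd2 Hd2']].
  exists d2; split; auto.
Qed.

Lemma ccont_inv D (z : C) : z <> 0%C -> ccont D Cinv z.
Proof.
  intros Hz. assert (Hm : 0 < Cmod z) by now apply Cmod_gt_0.
  intros eps He.
  assert (Hd : 0 < Cmod z * Cmod z / 2 * eps) by (apply Rmult_lt_0_compat; nra).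
  exists (Rmin (Cmod z / 2) (Cmod z * Cmod z / 2 * eps)).
  split; [apply Rmin_pos; lra|]. intros w _ Hw.
  pose proof (Rlt_le_trans _ _ _ Hw (Rmin_l _ _)) as H1.
  pose proof (Rlt_le_trans _ _ _ Hw (Rmin_r _ _)) as H2.
  pose proof (Cmod_le_sub z w) as H3. rewrite Cmod_sub_sym in H3.
  assert (Hw0 : w <> 0%C). { apply Cmod_gt_0; lra. }
  replace (/ w - / z)%C with (- (w - z) / (w * z))%C by (field; auto).
  rewrite Cmod_div, Cmod_opp, Cmod_mult by now apply Cmult_neq_0.
  apply Rlt_div_l; [nra|]. assert (Cmod z / 2 < Cmod w) by lra. nra.
Qed.

Lemma rcont_plus D u v z :
  rcont D u z -> rcont D v z -> rcont D (fun w => u w + v w) z.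
Proof.
  intros Hu Hv. eapply vanishes_le; [|exact (vanishes_plus _ _ _ _ Hu Hv)].
  intros w _. cbv beta. replace (u w + v w - (u z + v z)) with ((u w - u z) + (v w - v z)) by ring.
  apply Rabs_triang.
Qed.

Lemma rcont_scal D u c z : rcont D u z -> rcont D (fun w => c * u w) z.
Proof.
  intros Hu. eapply vanishes_le; [|exact (vanishes_scal _ _ _ _ (Rabs_pos c) Hu)].
  intros w _. cbv beta. rewrite <- Rabs_mult. right; f_equal; ring.
Qed.

Lemma rcont_sum D (u : nat -> C -> R) n z :
  (forall k, rcont D (u k) z) -> rcont D (fun w => sum_f_R0 (fun k => u k w) n) z.
Proof.
  intros Hu. induction n; simpl; [apply Hu | now apply rcont_plus].
Qed.

Lemma rcont_comp D D' u g z :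
  (forall w, D w -> D' (g w)) -> ccont D g z -> rcont D' u (g z) -> rcont D (fun w => u (g w)) z.
Proof.
  intros S Hg Hf eps He.
  destruct (Hf eps He) as [d [Hd Hd']]. destruct (Hg d Hd) as [d2 [Hd2 Hd2']].
  exists d2; split; auto.
Qed.

Lemma rcont_fst D f z : ccont D f z -> rcont D (fun w => fst (f w)) z.
Proof.
  apply vanishes_le. intros w _.
  change (Rabs (fst (f w - f z)%C) <= Cmod (f w - f z)).
  eapply Rle_trans; [|apply Rmax_Cmod]. apply Rmax_l.
Qed.

Lemma rcont_Cmod D f z : ccont D f z -> rcont D (fun w => Cmod (f w)) z.
Proof. apply vanishes_le. intros w _. apply Rabs_Cmod_sub. Qed.

Lemma rcont_rpow D u p z : 0 < p -> (forall w, 0 <= u w) ->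
  rcont D u z -> rcont D (fun w => rpow (u w) p) z.
Proof.
  intros Hp P Hu eps He.
  destruct (rpow_continuous p (u z) Hp (P z) eps He) as [d [Hd Hd']].
  destruct (Hu d Hd) as [d2 [Hd2 Hd2']]. exists d2; split; auto.
Qed.

Lemma rcont_Cmod_rpow D f p z : 0 < p ->
  ccont D f z -> rcont D (fun w => rpow (Cmod (f w)) p) z.
Proof.
  intros Hp Hf. apply rcont_rpow; auto using Cmod_ge_0, rcont_Cmod.
Qed.

Lemma Cmod_le_Rabs (z : C) : Cmod z <= Rabs (fst z) + Rabs (snd z).
Proof.
  pose proof (Cmod_ge_0 z). pose proof (Cmod_sqr z).
  pose proof (Rabs_pos (fst z)). pose proof (Rabs_pos (snd z)).
  pose proof (Rsqr_abs (fst z)). pose proof (Rsqr_abs (snd z)). unfold Rsqr in *. nra.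
Qed.

(* The points of the square [-r, r]^2 outside the disc get a ball that misses the disc. *)
Lemma cdisc_lebesgue_number r (delta : C -> posreal) :
  exists d, 0 < d /\ forall z, cdisc r z ->
    exists u, cdisc r u /\ Cmod (z - u) < delta u /\ d <= delta u.
Proof.
  assert (Hout : forall u, 0 < if Rle_dec (Cmod u) r then delta u / 2 else (Cmod u - r) / 2).
  { intros u. pose proof (cond_pos (delta u)). destruct (Rle_dec (Cmod u) r); lra. }
  destruct (compactness_value_2d (- r) r (- r) r
    (fun x y => mkposreal _ (Hout (x, y)))) as [d Hd].
  exists d; split; [apply cond_pos|]. intros z Hz.
  pose proof (Rmax_Cmod z) as Hm. unfold cdisc in Hz.
  assert (Hx : Rabs (fst z) <= r) by (pose proof (Rmax_l (Rabs (fst z)) (Rabs (snd z))); lra).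
  assert (Hy : Rabs (snd z) <= r) by (pose proof (Rmax_r (Rabs (fst z)) (Rabs (snd z))); lra).
  apply Rabs_le_between in Hx, Hy.
  destruct (NNPP _ (Hd _ _ Hx Hy)) as [x [y [_ [_ [H1 [H2 H3]]]]]].
  simpl in H1, H2, H3.
  exists (x, y).
  pose proof (Cmod_le_Rabs (z - (x, y))) as Hs. simpl in Hs.
  pose proof (Cmod_le_sub (x, y) z) as Hc. rewrite Cmod_sub_sym in Hc.
  unfold Rminus in *.
  destruct (Rle_dec (Cmod (x, y)) r) as [Hle | Hgt].
  - pose proof (cond_pos (delta (x, y))). repeat split; [exact Hle | lra..].
  - exfalso. lra.
Qed.

(** Two close points lie in a common ball of the cover by a Lebesgue number argument. The conclusion
    compares both with the centre [u] of that ball; the complex and the real version of uniform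
    continuity then need only a triangle inequality. The factor 2 in the choice of radii leaves room
    for the second point. *)
Lemma cdisc_uniform r (e : C -> C -> R) :
  (forall z, cdisc r z -> vanishes (cdisc r) (e z) z) ->
  forall eps, 0 < eps -> exists d, 0 < d /\ forall z w, cdisc r z -> cdisc r w ->
    Cmod (w - z) < d -> exists u, e u z < eps /\ e u w < eps.
Proof.
  intros He eps Heps.
  assert (Hex : forall u, exists d : posreal, cdisc r u ->
     forall w, cdisc r w -> Cmod (w - u) < 2 * d -> e u w < eps).
  { intros u. destruct (classic (cdisc r u)) as [Hu | Hu].
    - destruct (He u Hu eps Heps) as [d [Hd Hd']].
      exists (pos_div_2 (mkposreal d Hd)). simpl. intros _ w Hw Hwu. apply Hd'; [assumption|lra].
    - exists (mkposreal 1 Rlt_0_1). tauto. }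
  set (delta := fun u => proj1_sig (constructive_indefinite_description _ (Hex u))).
  destruct (cdisc_lebesgue_number r delta) as [d [Hd Hd']].
  exists d; split; [assumption|]. intros z w Hz Hw Hzw.
  destruct (Hd' z Hz) as [u [Hu [Hzu Hdu]]]. exists u.
  pose proof (proj2_sig (constructive_indefinite_description _ (Hex u)) Hu) as H.
  change (proj1_sig (constructive_indefinite_description _ (Hex u))) with (delta u) in H.
  pose proof (cond_pos (delta u)).
  split; apply H; try assumption; [lra|].
  replace (w - u)%C with ((w - z) + (z - u))%C by ring.
  eapply Rle_lt_trans; [apply Cmod_triangle|]. lra.
Qed.

Lemma cdisc_uniform_C r (f : C -> C) :
  (forall z, cdisc r z -> ccont (cdisc r) f z) ->
  forall eps, 0 < eps -> exists d, 0 < d /\ forall z w, cdisc r z -> cdisc r w ->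
    Cmod (w - z) < d -> Cmod (f w - f z) < eps.
Proof.
  intros Hf eps He.
  destruct (cdisc_uniform r (fun z w => Cmod (f w - f z)) Hf (eps / 2)) as [d [Hd H]]; [lra|].
  exists d; split; [assumption|]. intros z w Hz Hw Hzw.
  destruct (H z w Hz Hw Hzw) as [u [H1 H2]].
  replace (f w - f z)%C with ((f w - f u) + (f u - f z))%C by ring.
  eapply Rle_lt_trans; [apply Cmod_triangle|]. rewrite (Cmod_sub_sym (f u)). lra.
Qed.

Lemma cdisc_uniform_R r (f : C -> R) :
  (forall z, cdisc r z -> rcont (cdisc r) f z) ->
  forall eps, 0 < eps -> exists d, 0 < d /\ forall z w, cdisc r z -> cdisc r w ->
    Cmod (w - z) < d -> Rabs (f w - f z) < eps.
Proof.
  intros Hf eps He.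
  destruct (cdisc_uniform r (fun z w => Rabs (f w - f z)) Hf (eps / 2)) as [d [Hd H]]; [lra|].
  exists d; split; [assumption|]. intros z w Hz Hw Hzw.
  destruct (H z w Hz Hw Hzw) as [u [H1 H2]].
  apply Rabs_def2 in H1, H2. apply Rabs_def1; lra.
Qed.

(** Walk from 0 to [z] along the radius in [m] equal steps shorter than the modulus of continuity
    for 1: each step changes [f] by less than 1, and [m] does not depend on [z]. *)
Lemma cdisc_bounded r (f : C -> R) : 0 <= r ->
  (forall z, cdisc r z -> rcont (cdisc r) f z) ->
  exists B, forall z, cdisc r z -> Rabs (f z) <= B.
Proof.
  intros Hr Hf. destruct (cdisc_uniform_R r f Hf 1 Rlt_0_1) as [d [Hd H]].
  destruct (nfloor_ex (r / d)) as [n [_ Hn]]; [apply Rdiv_le_0_compat; lra|].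
  apply Rlt_div_l in Hn; [|assumption]. rewrite <- S_INR in Hn.
  set (m := S n) in *. assert (Hm : 0 < INR m) by apply lt_0_INR, Nat.lt_0_succ.
  exists (Rabs (f 0) + INR m). intros z Hz.
  assert (Hk : forall k, (k <= m)%nat -> Rabs (f (RtoC (INR k / INR m) * z)%C - f 0) <= INR k).
  { assert (Hin : forall k, (k <= m)%nat -> cdisc r (RtoC (INR k / INR m) * z)%C).
    { intros k Hk. unfold cdisc. rewrite Cmod_mult, Cmod_R, Rabs_pos_eq.
      2: { apply Rdiv_le_0_compat; [apply pos_INR | assumption]. }
      assert (INR k / INR m <= 1).
      { apply Rle_div_l; [assumption|]. rewrite Rmult_1_l. now apply le_INR. }
      pose proof (Cmod_ge_0 z). unfold cdisc in Hz. nra. }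
    induction k as [|k IH]; intros Hk.
    - change (INR 0) with 0. replace (RtoC (0 / INR m) * z)%C with (RtoC 0).
      2: { unfold Rdiv. rewrite Rmult_0_l. ring. }
      rewrite Rminus_diag, Rabs_R0. lra.
    - specialize (IH ltac:(lia)).
      assert (Hs := H _ _ (Hin k ltac:(lia)) (Hin (S k) Hk)).
      replace (RtoC (INR (S k) / INR m) * z - RtoC (INR k / INR m) * z)%C
        with (RtoC (/ INR m) * z)%C in Hs.
      2: { rewrite S_INR. replace (/ INR m) with ((INR k + 1) / INR m - INR k / INR m) by (field; lra).
           rewrite RtoC_minus. ring. }
      rewrite Cmod_mult, Cmod_R, Rabs_pos_eq in Hs
        by (left; now apply Rinv_0_lt_compat).
      specialize (Hs ltac:(apply (Rmult_lt_reg_l (INR m)); [assumption|];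
        rewrite <- Rmult_assoc, Rinv_r, Rmult_1_l by lra; unfold cdisc in Hz; lra)).
      pose proof (S_INR k). apply Rabs_def2 in Hs. apply Rabs_le_between in IH.
      apply Rabs_le. lra. }
  specialize (Hk m (le_n _)).
  replace (RtoC (INR m / INR m) * z)%C with z in Hk.
  2: { unfold Rdiv. rewrite Rinv_r by lra. ring. }
  pose proof (Rabs_triang_inv (f z) (f 0)). lra.
Qed.

(** If the supremum [S] were not attained, [1 / (S - f)] would be continuous, hence bounded by some
    [K], and [S - 1 / K] would be a smaller upper bound. *)
Lemma cdisc_max r (f : C -> R) : 0 <= r ->
  (forall z, cdisc r z -> rcont (cdisc r) f z) ->
  exists z, cdisc r z /\ forall w, cdisc r w -> f w <= f z.
Proof.
  intros Hr Hf. apply NNPP; intros Hno.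
  destruct (cdisc_bounded r f Hr Hf) as [B HB].
  destruct (completeness (fun y => exists z, cdisc r z /\ y = f z)) as [S [HS1 HS2]].
  { exists B. intros y [z [Hz ->]]. specialize (HB z Hz). apply Rabs_le_between in HB. lra. }
  { exists (f 0), 0%C. split; [|reflexivity]. unfold cdisc. now rewrite Cmod_0. }
  assert (Hlt : forall z, cdisc r z -> 0 < S - f z).
  { intros z Hz. destruct (HS1 (f z)) as [H | H]; [now exists z | lra |].
    exfalso. apply Hno. exists z; split; [assumption|]. intros w Hw. rewrite H.
    apply HS1. now exists w. }
  destruct (cdisc_bounded r (fun z => / (S - f z)) Hr) as [K HK].
  { intros z Hz eps He. pose proof (Hlt z Hz) as H0. set (s := S - f z) in *.
    assert (Hp : 0 < s * s / 2 * eps) by (apply Rmult_lt_0_compat; nra).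
    destruct (Hf z Hz (Rmin (s / 2) (s * s / 2 * eps))) as [d [Hd Hd']];
      [apply Rmin_pos; lra|].
    exists d; split; [assumption|]. intros w Hw Hwz. specialize (Hd' w Hw Hwz).
    pose proof (Rlt_le_trans _ _ _ Hd' (Rmin_l _ _)) as H1.
    pose proof (Rlt_le_trans _ _ _ Hd' (Rmin_r _ _)) as H2.
    apply Rabs_def2 in H1. set (t := S - f w) in *.
    replace (f w - f z) with (s - t) in * by (unfold s, t; ring).
    replace (/ t - / s) with ((s - t) / (t * s)) by (field; lra).
    rewrite Rabs_div, (Rabs_pos_eq (t * s)) by nra.
    apply Rlt_div_l; [nra|]. assert (s / 2 < t) by lra. nra. }
  assert (HK0 : 0 < K).
  { assert (D0 : cdisc r 0) by (unfold cdisc; now rewrite Cmod_0).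
    specialize (HK _ D0). specialize (Hlt _ D0). apply Rinv_0_lt_compat in Hlt.
    rewrite Rabs_pos_eq in HK; lra. }
  assert (S <= S - / K).
  { apply HS2. intros y [z [Hz ->]]. specialize (HK z Hz). specialize (Hlt z Hz).
    pose proof (Rinv_0_lt_compat _ Hlt). rewrite Rabs_pos_eq in HK by lra.
    apply Rinv_le_contravar in HK; [|assumption]. rewrite Rinv_inv in HK. lra. }
  apply Rinv_0_lt_compat in HK0. lra.
Qed.

(** * Circles and polar coordinates *)

Lemma circ_plus r t : circ r t = (RtoC r * circ 1 t)%C.
Proof. unfold circ. simpl. apply injective_projections; simpl; ring. Qed.

Lemma Cmod_circ r t : 0 <= r -> Cmod (circ r t) = r.
Proof.
  intros Hr. unfold Cmod, circ; simpl.
  replace (_ + _) with (r * r).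
  - now apply sqrt_square.
  - pose proof (sin2_cos2 t) as H. unfold Rsqr in H. nra.
Qed.

Lemma circ_0 t : circ 0 t = 0%C.
Proof. unfold circ. now rewrite !Rmult_0_l. Qed.

Lemma circ_mult r s t u : (circ r t * circ s u)%C = circ (r * s) (t + u).
Proof.
  unfold circ. rewrite cos_plus, sin_plus. apply injective_projections; simpl; ring.
Qed.

Lemma circ_period r t : circ r (t + 2 * PI) = circ r t.
Proof.
  unfold circ. now rewrite cos_plus, sin_plus, cos_2PI, sin_2PI, !Rmult_0_r, !Rmult_1_r,
    Rminus_0_r, Rplus_0_r.
Qed.

Lemma Cmod_circ_sub r t u : 0 <= r -> Cmod (circ r t - circ r u) <= r * (2 * Rabs (t - u)).
Proof.
  intros Hr.
  assert (Hl : forall g g' : R -> R, (forall x, derivable_pt_lim g x (g' x)) ->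
     (forall x, -1 <= g' x <= 1) -> Rabs (g t - g u) <= Rabs (t - u)).
  { intros g g' Hg Hb.
    destruct (MVT_gen g u t g') as [c [_ Hc]].
    - intros x _. apply is_derive_Reals, Hg.
    - intros x _. apply derivable_continuous_pt. eexists; apply Hg.
    - rewrite Hc, Rabs_mult. rewrite <- (Rmult_1_l (Rabs (t - u))) at 2.
      apply Rmult_le_compat_r; [apply Rabs_pos|]. apply Rabs_le, Hb. }
  eapply Rle_trans; [apply Cmod_le_Rabs|]. simpl.
  replace (r * cos t + - (r * cos u)) with (r * (cos t - cos u)) by ring.
  replace (r * sin t + - (r * sin u)) with (r * (sin t - sin u)) by ring.
  rewrite !Rabs_mult, (Rabs_pos_eq r) by assumption.
  rewrite <- Rmult_plus_distr_l. apply Rmult_le_compat_l; [assumption|].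
  pose proof (Hl sin cos derivable_pt_lim_sin COS_bound).
  assert (Hn : forall x, -1 <= - sin x <= 1) by (intros x; pose proof (SIN_bound x); lra).
  pose proof (Hl cos (fun x => - sin x) derivable_pt_lim_cos Hn). lra.
Qed.

Lemma polar_form (z : C) : exists t, 0 <= t < 2 * PI /\ z = circ (Cmod z) t.
Proof.
  pose proof PI_RGT_0 as Hpi.
  destruct (classic (z = 0%C)) as [-> | Hz].
  { exists 0. split; [lra|]. rewrite Cmod_0. now rewrite circ_0. }
  apply Cmod_gt_0 in Hz. set (m := Cmod z) in *.
  pose proof (Cmod_sqr z) as Hs. fold m in Hs.
  set (x := fst z / m). set (y := snd z / m).
  assert (Ex : fst z = m * x) by (unfold x; field; lra).
  assert (Ey : snd z = m * y) by (unfold y; field; lra).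
  rewrite Ex, Ey in Hs. assert (H1 : x * x + y * y = 1).
  { apply (Rmult_eq_reg_l (m * m)); nra. }
  assert (Hx : -1 <= x <= 1) by nra.
  pose proof (acos_bound x) as Hb.
  destruct (Rle_lt_dec 0 y) as [Hy | Hy].
  - exists (acos x). split; [lra|]. apply injective_projections; simpl.
    + now rewrite cos_acos.
    + rewrite sin_acos by assumption.
      replace (1 - Rsqr x) with (y * y) by (unfold Rsqr; lra). now rewrite sqrt_square.
  - exists (2 * PI - acos x).
    assert (acos x <> 0).
    { intros E. assert (x = 1) by (rewrite <- (cos_acos x), E by assumption; apply cos_0). nra. }
    split; [lra|]. apply injective_projections; simpl.
    + rewrite cos_minus, cos_2PI, sin_2PI, cos_acos by assumption. rewrite Ex. ring.
    + rewrite sin_minus, cos_2PI, sin_2PI, sin_acos by assumption.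
      replace (1 - Rsqr x) with ((- y) * (- y)) by (unfold Rsqr; lra).
      rewrite sqrt_square by lra. rewrite Ey; ring.
Qed.

(** * Complex differentiability and Goursat's theorem *)

(* Caratheodory's form of complex differentiability. *)
Definition cdiff (f : C -> C) (z : C) : Prop :=
  exists phi, ccont inD phi z /\ forall w, f w = (f z + phi w * (w - z))%C.

Lemma is_derive_cdiff (f : C -> C) (z l : C) :
  @is_derive C_AbsRing C_NormedModule f z l -> cdiff f z.
Proof.
  intros [_ H].
  exists (fun w : C => if excluded_middle_informative (w = z) then l
                   else ((f w - f z) / (w - z))%C).
  split.
  - intros eps He.
    specialize (H z (fun P HP => HP) (mkposreal (eps / 2) ltac:(lra))).
    destruct H as [d Hd]. exists d; split; [apply cond_pos|].
    intros w _ Hw. cbv beta.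
    destruct (excluded_middle_informative (z = z)) as [_|E]; [|now elim E].
    destruct (excluded_middle_informative (w = z)) as [_|E];
      [rewrite Cmod_0_sub; lra|].
    assert (E' : (w - z)%C <> 0).
    { intros E0. apply E. replace w with (w - z + z)%C by ring. rewrite E0; ring. }
    specialize (Hd w Hw).
    change (Cmod (f w - f z - (w - z) * l) <= eps / 2 * Cmod (w - z)) in Hd.
    replace ((f w - f z) / (w - z) - l)%C with ((f w - f z - (w - z) * l) / (w - z))%C
      by (field; assumption).
    rewrite Cmod_div by assumption. apply Cmod_gt_0 in E'.
    apply Rlt_div_l; [assumption|]. nra.
  - intros w. destruct (excluded_middle_informative (w = z)) as [-> | E]; [ring|].
    field. intros E0. apply E. replace w with (w - z + z)%C by ring. rewrite E0; ring.
Qed.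

Lemma cdiff_eps f z l : (forall w, f w = (f z + l w * (w - z))%C) -> ccont inD l z ->
  inD z -> forall eps, 0 < eps -> exists d, 0 < d /\ forall w, Cmod (w - z) < d ->
    Cmod (f w - f z - l z * (w - z)) <= eps * Cmod (w - z).
Proof.
  intros E Hl Hz eps He. destruct (Hl eps He) as [d [Hd H]].
  unfold inD in Hz.
  (* The factor [l] is continuous relative to the disc only, so the ball must stay inside it. *)
  exists (Rmin d (1 - Cmod z)); split; [apply Rmin_pos; lra|]. intros w Hw.
  pose proof (Rlt_le_trans _ _ _ Hw (Rmin_l _ _)) as H1.
  pose proof (Rlt_le_trans _ _ _ Hw (Rmin_r _ _)) as H2.
  rewrite (E w). replace (f z + l w * (w - z) - f z - l z * (w - z))%C
    with ((l w - l z) * (w - z))%C by ring.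
  rewrite Cmod_mult. apply Rmult_le_compat_r; [apply Cmod_ge_0|].
  left; apply H; [|assumption]. unfold inD. pose proof (Cmod_le_sub w z). lra.
Qed.

Lemma cdiff_is_derive (f : C -> C) (z : C) : inD z -> cdiff f z ->
  exists l, @is_derive C_AbsRing C_NormedModule f z l.
Proof.
  intros Hz [phi [Hphi E]]. exists (phi z). split.
  - apply is_linear_scal_l.
  - intros x Hx. apply (@is_filter_lim_locally_unique C_AbsRing (AbsRing_NormedModule C_AbsRing)) in Hx.
    subst x. intros eps.
    destruct (cdiff_eps f z phi E Hphi Hz eps (cond_pos eps)) as [d [Hd H]].
    exists (mkposreal d Hd). intros w Hw. specialize (H w Hw).
    change (Cmod (f w - f z - (w - z) * phi z) <= eps * Cmod (w - z)).
    now rewrite (Cmult_comm (w - z)).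
Qed.

Lemma holo_cdiff f : holo_D f <-> forall z, inD z -> cdiff f z.
Proof.
  split.
  - intros H z Hz. destruct (H z Hz) as [l Hl]. now apply is_derive_cdiff in Hl.
  - intros H z Hz. now apply cdiff_is_derive; [|apply H].
Qed.

Lemma cdiff_ccont f z : cdiff f z -> ccont inD f z.
Proof.
  intros [phi [Hphi E]].
  assert (H : ccont inD (fun w => f z + phi w * (w + - z))%C z).
  { apply ccont_plus; [apply ccont_const|]. apply ccont_mult; [assumption|].
    apply ccont_plus; [apply ccont_id | apply ccont_const]. }
  eapply vanishes_le; [|exact H]. intros w _. cbv beta.
  rewrite (E w). right; f_equal. ring.
Qed.

Lemma cdiff_const c z : cdiff (fun _ => c) z.
Proof. exists (fun _ => 0%C). split; [apply ccont_const | intros; ring]. Qed.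

Lemma cdiff_id z : cdiff (fun w => w) z.
Proof. exists (fun _ => 1%C). split; [apply ccont_const | intros; ring]. Qed.

Lemma cdiff_plus f g z : cdiff f z -> cdiff g z -> cdiff (fun w => f w + g w)%C z.
Proof.
  intros [a [Ha Ea]] [b [Hb Eb]]. exists (fun w => a w + b w)%C.
  split; [now apply ccont_plus|]. intros w. rewrite (Ea w), (Eb w). ring.
Qed.

Lemma cdiff_mult f g z : cdiff f z -> cdiff g z -> cdiff (fun w => f w * g w)%C z.
Proof.
  intros Hf Hg. pose proof (cdiff_ccont _ _ Hg) as Cg.
  destruct Hf as [a [Ha Ea]], Hg as [b [Hb Eb]].
  exists (fun w => a w * g w + f z * b w)%C.
  split; [apply ccont_plus; apply ccont_mult; auto using ccont_const|].
  intros w. rewrite (Ea w), (Eb w). ring.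
Qed.

Lemma cdiff_comp f g z : (forall w, inD w -> inD (g w)) ->
  cdiff g z -> cdiff f (g z) -> cdiff (fun w => f (g w)) z.
Proof.
  intros S Hg [a [Ha Ea]]. pose proof (cdiff_ccont _ _ Hg) as Cg.
  destruct Hg as [b [Hb Eb]]. exists (fun w => a (g w) * b w)%C. split.
  - apply ccont_mult; [|assumption]. now apply ccont_comp with inD.
  - intros w. rewrite (Ea (g w)), (Eb w). ring.
Qed.

(** The counterclockwise circulation of the form [P ds + Q dt] around the rectangle with sides
    [[x, x']] and [[y, y']], opposite sides being grouped together. *)
Definition rect_form (P Q : R -> R -> R) (x x' y y' : R) : R :=
  RInt (fun s => P s y - P s y') x x' + RInt (fun t => Q x' t - Q x t) y y'.

(** [T x y h] is a property of the rectangle with lower left corner [(x, y)] and sides [h * A],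
    [h * B]. If it failed for the whole, it would fail for one quarter, then for a quarter of that,
    and so on; the nested failures shrink to a point [(u, v)], where the local hypothesis forbids
    them. *)
Lemma bisection_2d (T : R -> R -> R -> Prop) (x0 y0 A B : R) :
  0 <= A -> 0 <= B ->
  (forall x y h, 0 < h ->
     T x y (h / 2) -> T (x + h / 2 * A) y (h / 2) ->
     T x (y + h / 2 * B) (h / 2) -> T (x + h / 2 * A) (y + h / 2 * B) (h / 2) -> T x y h) ->
  (forall u v, x0 <= u <= x0 + A -> y0 <= v <= y0 + B -> exists d, 0 < d /\
     forall x y h, 0 < h < d -> x <= u <= x + h * A -> y <= v <= y + h * B -> T x y h) ->
  T x0 y0 1.
Proof.
  intros HA HB Hsplit Hloc. apply NNPP; intros Hno.
  set (step := fun h (s s' : R * R) =>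
    ~ T (fst s') (snd s') (h / 2) /\
    fst s <= fst s' /\ fst s' + h / 2 * A <= fst s + h * A /\
    snd s <= snd s' /\ snd s' + h / 2 * B <= snd s + h * B).
  assert (Hstep : forall h s, 0 < h -> ~ T (fst s) (snd s) h -> exists s', step h s s').
  { intros h [x y] Hh Hs. simpl in Hs. apply NNPP; intros Hn. apply Hs.
    assert (0 <= h * A) by nra. assert (0 <= h * B) by nra.
    assert (Hc : forall x' y', (x' = x \/ x' = x + h / 2 * A) -> (y' = y \/ y' = y + h / 2 * B) ->
      T x' y' (h / 2)).
    { intros x' y' Hx Hy. apply NNPP; intros Hx'. apply Hn. exists (x', y').
      unfold step; simpl. split; [assumption|].
      destruct Hx as [-> | ->], Hy as [-> | ->]; repeat split; lra. }
    apply Hsplit; auto. }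
  (* Where no failing quarter exists the choice is meaningless; [HT] shows by induction that this
     never happens along the sequence [s]. *)
  set (next := fun h s => epsilon (inhabits s) (step h s)).
  set (s := fix s n := match n with O => (x0, y0) | S n => next ((1 / 2) ^ n) (s n) end).
  assert (Hp : forall n, 0 < (1 / 2) ^ n) by (intros; apply pow_lt; lra).
  assert (HT : forall n, ~ T (fst (s n)) (snd (s n)) ((1 / 2) ^ n)).
  { induction n; [exact Hno|].
    destruct (epsilon_spec (inhabits (s n)) _ (Hstep _ _ (Hp n) IHn)) as [H _].
    replace ((1 / 2) ^ S n) with ((1 / 2) ^ n / 2) by (simpl; lra). exact H. }
  assert (HS : forall n, step ((1 / 2) ^ n) (s n) (s (S n))).
  { intros n. exact (epsilon_spec (inhabits (s n)) _ (Hstep _ _ (Hp n) (HT n))). }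
  assert (Hlim : forall (c : R * R -> R) L, 0 <= L ->
     (forall n, c (s n) <= c (s (S n)) /\
        c (s (S n)) + (1 / 2) ^ S n * L <= c (s n) + (1 / 2) ^ n * L) ->
     exists u, forall n, c (s n) <= u <= c (s n) + (1 / 2) ^ n * L).
  { intros c L HL Hc.
    assert (Hmono : forall n k, c (s n) <= c (s (k + n)%nat) /\
        c (s (k + n)%nat) + (1 / 2) ^ (k + n) * L <= c (s n) + (1 / 2) ^ n * L).
    { intros n k. induction k as [|k IH]; [simpl; lra|].
      destruct (Hc (k + n)%nat). simpl in *. lra. }
    assert (Hle : forall n m, c (s m) <= c (s n) + (1 / 2) ^ n * L).
    { intros n m. pose proof (Hmono n m) as H1. pose proof (Hmono m n) as H2.
      rewrite Nat.add_comm in H2. pose proof (Hp (m + n)%nat).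
      assert (0 <= (1 / 2) ^ (m + n) * L) by nra. lra. }
    destruct (completeness (fun y => exists n, y = c (s n))) as [u [Hu1 Hu2]].
    - exists (c (s 0%nat) + (1 / 2) ^ 0 * L). intros y [n ->]. apply Hle.
    - now exists (c (s 0%nat)), 0%nat.
    - exists u. intros n. split; [apply Hu1; now exists n|].
      apply Hu2. intros y [m ->]. apply Hle. }
  destruct (Hlim fst A HA) as [u Hu].
  { intros n. destruct (HS n) as [_ H]. simpl pow. lra. }
  destruct (Hlim snd B HB) as [v Hv].
  { intros n. destruct (HS n) as [_ H]. simpl pow. lra. }
  destruct (Hloc u v) as [d [Hd H]].
  { specialize (Hu 0%nat). simpl in Hu. lra. }
  { specialize (Hv 0%nat). simpl in Hv. lra. }
  destruct (pow_lt_1_zero (1 / 2) ltac:(rewrite Rabs_pos_eq; lra) d Hd) as [n Hn].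
  specialize (Hn n (le_n _)). rewrite Rabs_pos_eq in Hn by (left; apply Hp).
  apply (HT n). apply H; auto.
Qed.

Lemma differentiable_continuous_1 f x y a b :
  differentiable_pt_lim f x y a b -> continuous (fun s => f s y) x.
Proof.
  intros H. apply continuity_pt_filterlim. intros eps He.
  assert (Hc : continuity_2d_pt f x y).
  { apply differentiable_continuity_pt. now exists a, b. }
  destruct (Hc (mkposreal eps He)) as [d Hd]. exists d. split; [apply cond_pos|].
  intros s [_ Hs]. apply Hd; [exact Hs|]. rewrite Rminus_diag, Rabs_R0. apply cond_pos.
Qed.

Lemma differentiable_continuous_2 f x y a b :
  differentiable_pt_lim f x y a b -> continuous (fun t => f x t) y.
Proof.
  intros H. apply continuity_pt_filterlim. intros eps He.
  assert (Hc : continuity_2d_pt f x y).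
  { apply differentiable_continuity_pt. now exists a, b. }
  destruct (Hc (mkposreal eps He)) as [d Hd]. exists d. split; [apply cond_pos|].
  intros s [_ Hs]. apply Hd; [|exact Hs]. rewrite Rminus_diag, Rabs_R0. apply cond_pos.
Qed.

Lemma RInt_near_const (f : R -> R) a b c e : a <= b -> ex_RInt f a b ->
  (forall t, a <= t <= b -> Rabs (f t - c) <= e) ->
  Rabs (RInt f a b - c * (b - a)) <= e * (b - a).
Proof.
  intros Hab Hf H.
  replace (RInt f a b - c * (b - a)) with (RInt (fun t => f t - c) a b).
  - rewrite Rmult_comm. apply abs_RInt_le_const; auto.
    apply (@ex_RInt_minus R_NormedModule); [assumption | apply ex_RInt_const].
  - transitivity (RInt f a b - RInt (fun _ => c) a b).
    + apply (@RInt_minus R_CompleteNormedModule); [assumption | apply ex_RInt_const].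
    + rewrite RInt_const. unfold scal; simpl; unfold mult; simpl. ring.
Qed.

Section Goursat.

Variables (P Q : R -> R -> R) (lo hi : R).
(** The common coefficient [k] says that the derivative of [P] in the second variable equals that of
    [Q] in the first, so the form is closed. Differentiability is pointwise, without continuity of
    the partial derivatives. Only the first variable, later the radius, is confined to an
    interval. *)
Hypothesis closed_form : forall x y, lo < x < hi -> exists a k b,
  differentiable_pt_lim P x y a k /\ differentiable_pt_lim Q x y k b.

Let contP x y : lo < x < hi -> continuous (fun s => P s y) x.
Proof.
  intros Hx. destruct (closed_form x y Hx) as [a [k [b [H _]]]].
  now apply differentiable_continuous_1 in H.
Qed.

Let contQ x y : lo < x < hi -> continuous (fun t => Q x t) y.
Proof.
  intros Hx. destruct (closed_form x y Hx) as [a [k [b [_ H]]]].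
  now apply differentiable_continuous_2 in H.
Qed.

Let exP x x' y y' : lo < x -> x <= x' -> x' < hi ->
  ex_RInt (fun s => P s y - P s y') x x'.
Proof.
  intros Hx Hx' Hx''. apply (@ex_RInt_continuous R_CompleteNormedModule). intros z Hz.
  rewrite Rmin_left, Rmax_right in Hz by assumption.
  apply (@continuous_minus _ R_AbsRing R_NormedModule); apply contP; lra.
Qed.

Let exQ x x' y y' : lo < x < hi -> lo < x' < hi ->
  ex_RInt (fun t => Q x' t - Q x t) y y'.
Proof.
  intros Hx Hx'. apply (@ex_RInt_continuous R_CompleteNormedModule). intros z _.
  apply (@continuous_minus _ R_AbsRing R_NormedModule); apply contQ; lra.
Qed.

Let split_x x xm x' y y' : lo < x -> x <= xm <= x' -> x' < hi ->
  rect_form P Q x x' y y' = rect_form P Q x xm y y' + rect_form P Q xm x' y y'.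
Proof.
  intros Hx Hm Hx'. unfold rect_form.
  rewrite <- (RInt_Chasles (fun s => P s y - P s y') x xm x') by (apply exP; lra).
  replace (RInt (fun t => Q x' t - Q x t) y y') with
    (RInt (fun t => Q xm t - Q x t) y y' + RInt (fun t => Q x' t - Q xm t) y y').
  - unfold plus; simpl. ring.
  - symmetry. etransitivity; [|apply (@RInt_plus R_CompleteNormedModule); apply exQ; lra].
    apply RInt_ext. intros t _. unfold plus; simpl. ring.
Qed.

Let split_y x x' y ym y' : lo < x -> x <= x' -> x' < hi ->
  rect_form P Q x x' y y' = rect_form P Q x x' y ym + rect_form P Q x x' ym y'.
Proof.
  intros Hx Hm Hx'. unfold rect_form.
  rewrite <- (RInt_Chasles (fun t => Q x' t - Q x t) y ym y') by (apply exQ; lra).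
  replace (RInt (fun s => P s y - P s y') x x') with
    (RInt (fun s => P s y - P s ym) x x' + RInt (fun s => P s ym - P s y') x x').
  - unfold plus; simpl. ring.
  - symmetry. etransitivity; [|apply (@RInt_plus R_CompleteNormedModule); apply exP; lra].
    apply RInt_ext. intros t _. unfold plus; simpl. ring.
Qed.

(* The affine part of the form at [(u, v)] integrates to [k * (y - y') * (x' - x)]
   horizontally and to its opposite vertically. *)
Let local_bound u v eps : lo < u < hi -> 0 < eps -> exists d, 0 < d /\
  forall x x' y y', lo < x -> x' < hi -> x <= u <= x' -> y <= v <= y' ->
    x' - x < d -> y' - y < d ->
    Rabs (rect_form P Q x x' y y') <= 2 * eps * ((x' - x) + (y' - y)) ^ 2.
Proof.
  intros Hu He. destruct (closed_form u v Hu) as [a [k [b [HP HQ]]]].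
  destruct (HP (mkposreal eps He)) as [d1 H1].
  destruct (HQ (mkposreal eps He)) as [d2 H2]. simpl in H1, H2.
  exists (Rmin d1 d2). split; [apply Rmin_pos; apply cond_pos|].
  intros x x' y y' Hx Hx' Hux Hvy Hdx Hdy.
  pose proof (Rmin_l d1 d2). pose proof (Rmin_r d1 d2).
  set (s := (x' - x) + (y' - y)).
  assert (HP' : forall p q, x <= p <= x' -> y <= q <= y' ->
     Rabs (P p q - P u v - (a * (p - u) + k * (q - v))) <= eps * s).
  { intros p q Hp Hq.
    assert (Rabs (p - u) <= x' - x) by (apply Rabs_le; lra).
    assert (Rabs (q - v) <= y' - y) by (apply Rabs_le; lra).
    eapply Rle_trans; [apply H1; lra|]. apply Rmult_le_compat_l; [lra|].
    unfold s. apply Rmax_lub; lra. }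
  assert (HQ' : forall p q, x <= p <= x' -> y <= q <= y' ->
     Rabs (Q p q - Q u v - (k * (p - u) + b * (q - v))) <= eps * s).
  { intros p q Hp Hq.
    assert (Rabs (p - u) <= x' - x) by (apply Rabs_le; lra).
    assert (Rabs (q - v) <= y' - y) by (apply Rabs_le; lra).
    eapply Rle_trans; [apply H2; lra|]. apply Rmult_le_compat_l; [lra|].
    unfold s. apply Rmax_lub; lra. }
  assert (I1 : Rabs (RInt (fun p => P p y - P p y') x x' - k * (y - y') * (x' - x))
      <= 2 * eps * s * (x' - x)).
  { apply RInt_near_const; [lra | apply exP; lra|]. intros p Hp.
    pose proof (HP' p y Hp ltac:(lra)) as A1. pose proof (HP' p y' Hp ltac:(lra)) as A2.
    apply Rabs_le_between in A1, A2. apply Rabs_le. lra. }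
  assert (I2 : Rabs (RInt (fun q => Q x' q - Q x q) y y' - k * (x' - x) * (y' - y))
      <= 2 * eps * s * (y' - y)).
  { apply RInt_near_const; [lra | apply exQ; lra|]. intros q Hq.
    pose proof (HQ' x q ltac:(lra) Hq) as A1. pose proof (HQ' x' q ltac:(lra) Hq) as A2.
    apply Rabs_le_between in A1, A2. apply Rabs_le. lra. }
  unfold rect_form. fold s.
  replace (2 * eps * s ^ 2) with (2 * eps * s * (x' - x) + 2 * eps * s * (y' - y))
    by (unfold s; ring).
  apply Rabs_le_between in I1, I2. apply Rabs_le. lra.
Qed.

(** The bound [2 * eps * (h * A + h * B) ^ 2] is quadratic in [h], so the bounds of the four
    quarters add up to the bound of the whole. Bisection therefore carries the local estimate to the
    full rectangle, and [eps] is arbitrary. *)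
Lemma goursat x x' y y' : lo < x -> x <= x' -> x' < hi -> y <= y' ->
  rect_form P Q x x' y y' = 0.
Proof.
  intros Hx Hxx Hx' Hyy.
  set (A := x' - x). set (B := y' - y).
  assert (Hb : forall eps, 0 < eps -> Rabs (rect_form P Q x x' y y') <= 2 * eps * (A + B) ^ 2).
  { intros eps He.
    set (T := fun p q h => lo < p -> p + h * A < hi ->
       Rabs (rect_form P Q p (p + h * A) q (q + h * B)) <= 2 * eps * (h * A + h * B) ^ 2).
    assert (HT : T x y 1).
    { apply bisection_2d with A B.
      - unfold A; lra.
      - unfold B; lra.
      - intros p q h Hh T1 T2 T3 T4 Hp Hp'. unfold T in *.
        assert (0 <= h * A) by (apply Rmult_le_pos; unfold A; lra).
        replace (p + h / 2 * A + h / 2 * A) with (p + h * A) in * by field.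
        replace (q + h / 2 * B + h / 2 * B) with (q + h * B) in * by field.
        specialize (T1 ltac:(lra) ltac:(lra)). specialize (T2 ltac:(lra) ltac:(lra)).
        specialize (T3 ltac:(lra) ltac:(lra)). specialize (T4 ltac:(lra) ltac:(lra)).
        rewrite (split_x p (p + h / 2 * A) (p + h * A)) by lra.
        rewrite (split_y p _ q (q + h / 2 * B)) by lra.
        rewrite (split_y (p + h / 2 * A) _ q (q + h / 2 * B)) by lra.
        replace (2 * eps * (h * A + h * B) ^ 2)
          with (4 * (2 * eps * (h / 2 * A + h / 2 * B) ^ 2)) by field.
        apply Rabs_le_between in T1, T2, T3, T4. apply Rabs_le. lra.
      - intros u v Hu Hv.
        destruct (local_bound u v eps ltac:(unfold A in Hu; lra) He) as [d [Hd H]].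
        exists (d / (A + B + 1)).
        assert (0 <= A) by (unfold A; lra). assert (0 <= B) by (unfold B; lra).
        split; [apply Rdiv_lt_0_compat; lra|].
        intros p q h [Hh Hhd] Hpu Hqv Hp Hp'.
        apply Rlt_div_r in Hhd; [|lra].
        eapply Rle_trans; [apply H; try lra; nra|].
        right. f_equal. f_equal. ring. }
    unfold T in HT. rewrite !Rmult_1_l in HT.
    replace (x + A) with x' in HT by (unfold A; ring).
    replace (y + B) with y' in HT by (unfold B; ring).
    now apply HT. }
  apply NNPP; intros Hn. apply Rabs_pos_lt in Hn.
  set (M := Rabs _) in *. assert (0 <= (A + B) ^ 2) by apply pow2_ge_0.
  specialize (Hb (M / (4 * ((A + B) ^ 2 + 1))) ltac:(apply Rdiv_lt_0_compat; lra)).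
  assert (2 * (M / (4 * ((A + B) ^ 2 + 1))) * (A + B) ^ 2 = M / 2 * ((A + B) ^ 2 / ((A + B) ^ 2 + 1)))
    by (field; lra).
  assert ((A + B) ^ 2 / ((A + B) ^ 2 + 1) <= 1) by (apply Rle_div_l; lra).
  nra.
Qed.

End Goursat.

(** * Mean values and the maximum principle *)

Definition avg (g : R -> R) : R := RInt g 0 (2 * PI) / (2 * PI).

Lemma two_PI_pos : 0 < 2 * PI.
Proof. pose proof PI_RGT_0; lra. Qed.

Definition cont (g : R -> R) : Prop := forall t, continuous g t.

Lemma cont_ex_RInt g a b : cont g -> ex_RInt g a b.
Proof. intros H. apply (@ex_RInt_continuous R_CompleteNormedModule). intros; apply H. Qed.

Lemma cont_const c : cont (fun _ => c).
Proof. intros t. apply continuous_const. Qed.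

Lemma cont_plus f g : cont f -> cont g -> cont (fun t => f t + g t).
Proof. intros Hf Hg t. apply (@continuous_plus _ R_AbsRing R_NormedModule); auto. Qed.

Lemma cont_scal c f : cont f -> cont (fun t => c * f t).
Proof. intros Hf t. apply (@continuous_scal_r _ R_AbsRing R_NormedModule); auto. Qed.

Lemma cont_sum (f : nat -> R -> R) n :
  (forall k, cont (f k)) -> cont (fun t => sum_f_R0 (fun k => f k t) n).
Proof. intros Hf. induction n; simpl; [apply Hf | now apply cont_plus]. Qed.

Lemma avg_ext f g : (forall t, f t = g t) -> avg f = avg g.
Proof. intros H. unfold avg. f_equal. now apply RInt_ext. Qed.

Lemma avg_const c : avg (fun _ => c) = c.
Proof.
  unfold avg. rewrite RInt_const. unfold scal; simpl; unfold mult; simpl.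
  pose proof PI_RGT_0. field; lra.
Qed.

Lemma avg_plus f g : cont f -> cont g -> avg (fun t => f t + g t) = avg f + avg g.
Proof.
  intros Hf Hg. unfold avg, Rdiv. rewrite <- Rmult_plus_distr_r. f_equal.
  apply (@RInt_plus R_CompleteNormedModule); now apply cont_ex_RInt.
Qed.

Lemma avg_scal c f : cont f -> avg (fun t => c * f t) = c * avg f.
Proof.
  intros Hf. unfold avg, Rdiv. rewrite <- Rmult_assoc. f_equal.
  apply (@RInt_scal R_CompleteNormedModule); now apply cont_ex_RInt.
Qed.

Lemma avg_sum (f : nat -> R -> R) n : (forall k, cont (f k)) ->
  avg (fun t => sum_f_R0 (fun k => f k t) n) = sum_f_R0 (fun k => avg (f k)) n.
Proof.
  intros Hf. induction n; simpl; [reflexivity|].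
  rewrite avg_plus, IHn; auto. now apply cont_sum.
Qed.

Lemma avg_le f g : cont f -> cont g -> (forall t, f t <= g t) -> avg f <= avg g.
Proof.
  intros Hf Hg H. pose proof two_PI_pos.
  apply Rmult_le_compat_r; [left; now apply Rinv_0_lt_compat|].
  apply RInt_le; auto using cont_ex_RInt. lra.
Qed.

Lemma avg_le_const f c : cont f -> (forall t, f t <= c) -> avg f <= c.
Proof.
  intros Hf H. rewrite <- (avg_const c). apply avg_le; auto using cont_const.
Qed.

Lemma avg_ge_const f c : cont f -> (forall t, c <= f t) -> c <= avg f.
Proof.
  intros Hf H. rewrite <- (avg_const c). apply avg_le; auto using cont_const.
Qed.

Lemma avg_shift g a : cont g -> (forall t, g (t + 2 * PI) = g t) ->
  avg (fun t => g (a + t)) = avg g.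
Proof.
  intros Hg Hp. unfold avg. f_equal.
  assert (Hsh : forall u x y, RInt (fun t => g (u + t)) x y = RInt g (u + x) (u + y)).
  { intros u x y. pose proof (RInt_comp_lin g 1 u x y (cont_ex_RInt _ _ _ Hg)) as E.
    replace (1 * x + u) with (u + x) in E by ring.
    replace (1 * y + u) with (u + y) in E by ring.
    rewrite <- E. apply RInt_ext. intros t _. unfold scal; simpl; unfold mult; simpl.
    rewrite Rmult_1_l. f_equal. ring. }
  rewrite Hsh, Rplus_0_r.
  rewrite <- (RInt_Chasles g a 0) by now apply cont_ex_RInt.
  rewrite <- (RInt_Chasles g 0 (2 * PI)) by now apply cont_ex_RInt.
  replace (RInt g (2 * PI) (a + 2 * PI)) with (RInt g 0 a).
  - rewrite <- (opp_RInt_swap g a 0) by now apply cont_ex_RInt.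
    unfold plus, opp; simpl. ring.
  - replace (RInt g 0 a) with (RInt (fun t => g (2 * PI + t)) 0 a).
    + rewrite Hsh. f_equal; ring.
    + apply RInt_ext. intros t _. rewrite Rplus_comm. apply Hp.
Qed.

(** If [g t < S], continuity keeps [g] below [(S + g t) / 2] on an interval of positive length,
    which pushes the mean strictly below [S]. *)
Lemma avg_max_eq g S : cont g -> (forall t, g t <= S) -> S <= avg g ->
  forall t, 0 <= t <= 2 * PI -> g t = S.
Proof.
  intros Hg Hle Havg t Ht. pose proof two_PI_pos as Hpi.
  destruct (Rle_lt_or_eq_dec _ _ (Hle t)) as [Hlt|]; [exfalso|assumption].
  assert (Hc : continuity_pt g t) by apply continuity_pt_filterlim, Hg.
  destruct (Hc ((S - g t) / 2)) as [d [Hd H]]; [lra|].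
  (* Clipping is needed because [t] may be an endpoint of the period. *)
  set (a := Rmax 0 (t - d / 2)). set (b := Rmin (2 * PI) (t + d / 2)).
  assert (Hab : 0 <= a /\ a < b /\ b <= 2 * PI /\ t - d / 2 <= a /\ b <= t + d / 2).
  { unfold a, b. pose proof (Rmax_l 0 (t - d / 2)). pose proof (Rmax_r 0 (t - d / 2)).
    pose proof (Rmin_l (2 * PI) (t + d / 2)). pose proof (Rmin_r (2 * PI) (t + d / 2)).
    repeat split; try assumption.
    apply Rmax_lub_lt; apply Rmin_glb_lt; lra. }
  destruct Hab as [H1 [H2 [H3 [H4 H5]]]].
  assert (Hub : forall x y c, x <= y -> (forall s, x < s < y -> g s <= c) ->
     RInt g x y <= (y - x) * c).
  { intros x y c Hxy Hs.
    replace ((y - x) * c) with (RInt (fun _ => c) x y).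
    - apply RInt_le; auto using cont_ex_RInt, ex_RInt_const.
    - rewrite RInt_const. reflexivity. }
  assert (E : RInt g 0 (2 * PI) = RInt g 0 a + (RInt g a b + RInt g b (2 * PI))).
  { rewrite <- (RInt_Chasles g 0 a) by now apply cont_ex_RInt.
    rewrite <- (RInt_Chasles g a b) by now apply cont_ex_RInt. reflexivity. }
  assert (A1 := Hub 0 a S ltac:(lra) ltac:(auto)).
  assert (A3 := Hub b (2 * PI) S ltac:(lra) ltac:(auto)).
  assert (A2 : RInt g a b <= (b - a) * ((S + g t) / 2)).
  { apply Hub; [lra|]. intros s Hs.
    destruct (Req_dec s t) as [-> | Hn]; [lra|].
    assert (Hd' : Rabs (g s - g t) < (S - g t) / 2).
    { apply (H s). split; [split; [exact I | auto]|]. apply Rabs_def1; lra. }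
    apply Rabs_def2 in Hd'. lra. }
  unfold avg in Havg. apply Rle_div_r in Havg; [|assumption]. nra.
Qed.

Lemma cont_rcont (D : C -> Prop) (u : C -> R) z0 r : 0 <= r ->
  (forall t, D (z0 + circ r t)%C) ->
  (forall z, D z -> rcont D u z) -> cont (fun t => u (z0 + circ r t)%C).
Proof.
  intros Hr HD Hu t. apply continuity_pt_filterlim. intros eps He.
  destruct (Hu _ (HD t) eps He) as [d [Hd H]].
  exists (d / (2 * (r + 1))). split; [apply Rdiv_lt_0_compat; lra|].
  intros s [_ Hs]. simpl in Hs. unfold Rdist in Hs.
  apply (H _ (HD s)).
  replace (z0 + circ r s - (z0 + circ r t))%C with (circ r s - circ r t)%C by ring.
  eapply Rle_lt_trans; [now apply Cmod_circ_sub|].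
  apply Rlt_div_r in Hs; [|lra]. pose proof (Rabs_pos (s - t)). nra.
Qed.

Lemma cont_circ (D : C -> Prop) (u : C -> R) r : 0 <= r ->
  (forall t, D (circ r t)) ->
  (forall z, D z -> rcont D u z) -> cont (fun t => u (circ r t)).
Proof.
  intros Hr HD Hu.
  assert (H : cont (fun t => u (0 + circ r t)%C)).
  { apply (cont_rcont D); auto. intros t. rewrite Cplus_0_l. apply HD. }
  intros t. eapply continuous_ext; [|apply H]. intros s. simpl. now rewrite Cplus_0_l.
Qed.

Lemma inD_circ r t : 0 <= r < 1 -> inD (circ r t).
Proof. intros Hr. unfold inD. rewrite Cmod_circ; lra. Qed.

Lemma inD_add_circ z r t : 0 <= r -> Cmod z + r < 1 -> inD (z + circ r t)%C.
Proof.
  intros Hr H. unfold inD. eapply Rle_lt_trans; [apply Cmod_triangle|].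
  rewrite Cmod_circ; lra.
Qed.

Lemma differentiable_mult c x y :
  differentiable_pt_lim (fun a b => c + a * b) x y y x.
Proof.
  intros eps. exists eps. intros u v Hu Hv.
  replace (c + u * v - (c + x * y) - (y * (u - x) + x * (v - y)))
    with ((v - y) * (u - x)) by ring.
  rewrite Rabs_mult. apply Rmult_le_compat; try apply Rabs_pos; [lra|apply Rmax_l].
Qed.

Lemma differentiable_proj2 f x y l : derivable_pt_lim f y l ->
  differentiable_pt_lim (fun _ v => f v) x y 0 l.
Proof.
  intros H eps. destruct (H eps (cond_pos eps)) as [d Hd]. exists d. intros u v _ Hv.
  destruct (Req_dec v y) as [-> | Hn].
  - replace (f y - f y - (0 * (u - x) + l * (y - y))) with 0 by ring. rewrite Rabs_R0.
    apply Rmult_le_pos; [left; apply cond_pos|].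
    eapply Rle_trans; [apply Rabs_pos | apply Rmax_l].
  - assert (Hn' : v - y <> 0) by lra.
    specialize (Hd (v - y) Hn' Hv). replace (y + (v - y)) with v in Hd by ring.
    replace (f v - f y - (0 * (u - x) + l * (v - y)))
      with (((f v - f y) / (v - y) - l) * (v - y)) by (field; assumption).
    rewrite Rabs_mult. apply Rmult_le_compat; try apply Rabs_pos; [lra|apply Rmax_r].
Qed.

Lemma cauchy_riemann f z : inD z -> cdiff f z -> exists a b,
  differentiable_pt_lim (fun x y => fst (f (x, y))) (fst z) (snd z) a (- b) /\
  differentiable_pt_lim (fun x y => snd (f (x, y))) (fst z) (snd z) b a.
Proof.
  intros Hz [l [Hl E]]. exists (fst (l z)), (snd (l z)).
  assert (H : forall eps : posreal, exists d : posreal, forall u v,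
     Rabs (u - fst z) < d -> Rabs (v - snd z) < d ->
     Cmod (f (u, v) - f z - l z * ((u, v) - z))
       <= eps * Rmax (Rabs (u - fst z)) (Rabs (v - snd z))).
  { intros eps.
    assert (Hp : 0 < eps / 2) by (pose proof (cond_pos eps); lra).
    destruct (cdiff_eps f z l E Hl Hz (eps / 2) Hp) as [d [Hd H]].
    exists (pos_div_2 (mkposreal d Hd)). simpl. intros u v Hu Hv.
    pose proof (Cmod_le_Rabs ((u, v) - z)) as Hm. simpl in Hm.
    eapply Rle_trans; [apply H; unfold Rminus in *; lra|].
    pose proof (Rmax_l (Rabs (u - fst z)) (Rabs (v - snd z))).
    pose proof (Rmax_r (Rabs (u - fst z)) (Rabs (v - snd z))).
    unfold Rminus in *. nra. }
  destruct z as [x y]. simpl fst in *; simpl snd in *.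
  split; intros eps; destruct (H eps) as [d Hd]; exists d; intros u v Hu Hv;
    specialize (Hd u v Hu Hv);
    (eapply Rle_trans; [|exact Hd]; eapply Rle_trans; [|apply Rmax_Cmod]).
  - eapply Rle_trans; [|apply Rmax_l]. right. f_equal. simpl. ring.
  - eapply Rle_trans; [|apply Rmax_r]. right. f_equal. simpl. ring.
Qed.

(* Goursat for the closed form [v dr / r + u dt] in polar coordinates around [z0]. *)
Lemma mean_value f z0 r : holo_D f -> 0 < r -> Cmod z0 + r < 1 ->
  avg (fun t => fst (f (z0 + circ r t)%C)) = fst (f z0).
Proof.
  intros Hf Hr Hz. rewrite holo_cdiff in Hf. pose proof two_PI_pos as Hpi.
  pose proof (Cmod_ge_0 z0) as Hz0.
  set (Q := fun s t => fst (f (z0 + circ s t)%C)).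
  (* The summand 0 gives [P] the shape of [differentiable_mult], to which the chain rule is
     applied. *)
  set (P := fun s t => 0 + / s * snd (f (z0 + circ s t)%C)).
  assert (Hcl : forall s t, 0 < s < 1 - Cmod z0 -> exists a k b,
     differentiable_pt_lim P s t a k /\ differentiable_pt_lim Q s t k b).
  { intros s t Hs.
    assert (Hin : inD (z0 + circ s t)%C) by (apply inD_add_circ; lra).
    destruct (cauchy_riemann f _ Hin (Hf _ Hin)) as [a [b [Hu Hv]]].
    assert (HX : differentiable_pt_lim (fun s t => fst z0 + s * cos t) s t
        (cos t * 1 + s * 0) (cos t * 0 + s * - sin t)).
    { apply (differentiable_pt_lim_comp (fun a b => fst z0 + a * b) (fun s _ => s)
        (fun _ t => cos t)); [apply differentiable_mult| |].
      - apply differentiable_pt_lim_proj1_0, derivable_pt_lim_id.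
      - apply differentiable_proj2, derivable_pt_lim_cos. }
    assert (HY : differentiable_pt_lim (fun s t => snd z0 + s * sin t) s t
        (sin t * 1 + s * 0) (sin t * 0 + s * cos t)).
    { apply (differentiable_pt_lim_comp (fun a b => snd z0 + a * b) (fun s _ => s)
        (fun _ t => sin t)); [apply differentiable_mult| |].
      - apply differentiable_pt_lim_proj1_0, derivable_pt_lim_id.
      - apply differentiable_proj2, derivable_pt_lim_sin. }
    pose proof (differentiable_pt_lim_comp _ _ _ _ _ _ _ _ _ _ _ Hu HX HY) as HQ.
    pose proof (differentiable_pt_lim_comp _ _ _ _ _ _ _ _ _ _ _ Hv HX HY) as HV.
    assert (HI : exists c, differentiable_pt_lim (fun s _ => / s) s t c 0).
    { eexists. apply differentiable_pt_lim_proj1_0, is_derive_Reals, Derive_correct.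
      auto_derive. lra. }
    destruct HI as [c HI].
    pose proof (differentiable_pt_lim_comp (fun a b => 0 + a * b) _ _ _ _ _ _ _ _ _ _
      (differentiable_mult 0 _ _) HI HV) as HP.
    eexists. exists (a * cos t - b * sin t). eexists. split.
    - eapply (eq_ind _ (fun k => differentiable_pt_lim P s t _ k)); [exact HP|]. cbv beta. field. lra.
    - eapply (eq_ind _ (fun k => differentiable_pt_lim Q s t k _)); [exact HQ|]. ring. }
  assert (HcQ : forall s, 0 < s < 1 - Cmod z0 -> cont (Q s)).
  { intros s Hs t. destruct (Hcl s t Hs) as [a [k [b [_ H]]]].
    now apply differentiable_continuous_2 in H. }
  (* In the polar rectangle the sides [t = 0] and [t = 2 * PI] cancel by periodicity, so the
     circulation theorem says that the circular mean does not depend on the radius. Shrinking the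
     circle then gives the value at the centre. *)
  assert (Heq : forall s, 0 < s <= r -> RInt (Q r) 0 (2 * PI) = RInt (Q s) 0 (2 * PI)).
  { intros s Hs.
    pose proof (goursat P Q 0 (1 - Cmod z0) Hcl s r 0 (2 * PI)
      ltac:(lra) ltac:(lra) ltac:(lra) ltac:(lra)) as G.
    unfold rect_form in G.
    rewrite (RInt_ext (fun x => P x 0 - P x (2 * PI)) (fun _ => 0)) in G.
    2: { intros x _. unfold P. replace (2 * PI) with (0 + 2 * PI) by ring.
         rewrite circ_period. apply Rminus_diag. }
    rewrite RInt_const in G.
    replace (RInt (fun t => Q r t - Q s t) 0 (2 * PI))
      with (RInt (Q r) 0 (2 * PI) - RInt (Q s) 0 (2 * PI)) in G.
    - unfold scal in G; simpl in G; unfold mult in G; simpl in G. lra.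
    - symmetry. apply (@RInt_minus R_CompleteNormedModule); apply cont_ex_RInt, HcQ; lra. }
  change (avg (Q r) = fst (f z0)).
  apply cond_eq. intros eps He.
  assert (Hin : inD z0) by (unfold inD; lra).
  pose proof (cdiff_ccont _ _ (Hf _ Hin)) as Hc. apply rcont_fst in Hc.
  destruct (Hc (eps / 2) ltac:(lra)) as [d [Hd H]].
  set (s := Rmin (d / 2) r).
  assert (Hs : 0 < s <= r).
  { split; [apply Rmin_pos; lra | apply Rmin_r]. }
  assert (s <= d / 2) by apply Rmin_l.
  unfold avg. rewrite (Heq s Hs). fold (avg (Q s)).
  assert (HQs : forall t, Rabs (Q s t - fst (f z0)) < eps / 2).
  { intros t. apply H; [apply inD_add_circ; lra|].
    replace (z0 + circ s t - z0)%C with (circ s t) by ring. rewrite Cmod_circ; lra. }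
  assert (avg (Q s) <= fst (f z0) + eps / 2).
  { apply avg_le_const; [apply HcQ; lra|]. intros t. specialize (HQs t).
    apply Rabs_def2 in HQs. lra. }
  assert (fst (f z0) - eps / 2 <= avg (Q s)).
  { apply avg_ge_const; [apply HcQ; lra|]. intros t. specialize (HQs t).
    apply Rabs_def2 in HQs. lra. }
  apply Rabs_def1; lra.
Qed.

Lemma holo_ccont f z : holo_D f -> inD z -> ccont inD f z.
Proof. intros Hf Hz. apply cdiff_ccont. now apply holo_cdiff. Qed.

Lemma cont_pow_circ f p z0 r : 0 < p -> holo_D f -> 0 <= r -> Cmod z0 + r < 1 ->
  cont (fun t => rpow (Cmod (f (z0 + circ r t)%C)) p).
Proof.
  intros Hp Hf Hr Hz.
  apply (cont_rcont inD (fun z => rpow (Cmod (f z)) p)); [assumption | |].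
  - intros t. now apply inD_add_circ.
  - intros z Hz'. apply rcont_Cmod_rpow; [assumption | now apply holo_ccont].
Qed.

(** The tangent inequality at [a = f z0] bounds [|f|^p] from below by [|a|^p] plus a multiple of the
    real part of [g]. This [g] is holomorphic and vanishes at [z0], so the mean of the linear term
    is 0. *)
Lemma sub_mean_value f p z0 r : 1 < p -> holo_D f -> 0 < r -> Cmod z0 + r < 1 ->
  rpow (Cmod (f z0)) p <= avg (fun t => rpow (Cmod (f (z0 + circ r t)%C)) p).
Proof.
  intros Hp Hf Hr Hz. set (a := f z0). set (k := p * rpow (Cmod a) (p - 2)).
  set (g := fun w => (Cconj a * (f w - a))%C).
  assert (Hg : holo_D g).
  { apply holo_cdiff. intros w Hw. unfold g.
    apply cdiff_mult; [apply cdiff_const|]. apply (cdiff_plus f (fun _ => - a)%C).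
    - now apply holo_cdiff.
    - apply cdiff_const. }
  assert (Hcg : cont (fun t => fst (g (z0 + circ r t)%C))).
  { apply (cont_rcont inD (fun z => fst (g z))); [lra | |].
    - intros t. apply inD_add_circ; lra.
    - intros z Hz'. now apply rcont_fst, holo_ccont. }
  transitivity (avg (fun t => rpow (Cmod a) p + k * fst (g (z0 + circ r t)%C))).
  - rewrite avg_plus, avg_const, avg_scal, (mean_value g) by
      (try assumption; try apply cont_const; now apply cont_scal).
    unfold g. fold a. replace (Cconj a * (a - a))%C with (RtoC 0) by ring. simpl. lra.
  - apply avg_le.
    + apply cont_plus; [apply cont_const | now apply cont_scal].
    + apply cont_pow_circ; lra || assumption.
    + intros t. now apply Cmod_tangent.
Qed.

(* At a maximum [z0], the circle around [z0] internally tangent to the boundary circle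
   carries the value of the maximum, in particular at the point of tangency. *)
Lemma max_principle (U : C -> R) r : 0 < r ->
  (forall z, cdisc r z -> rcont (cdisc r) U z) ->
  (forall z s, 0 < s -> Cmod z + s <= r -> U z <= avg (fun t => U (z + circ s t)%C)) ->
  forall z, cdisc r z -> exists t, U z <= U (circ r t).
Proof.
  intros Hr Hc Hsub z Hz.
  destruct (cdisc_max r U ltac:(lra) Hc) as [z0 [Hz0 Hmax]].
  destruct (polar_form z0) as [t [Ht Ez]]. exists t.
  apply Rle_trans with (U z0); [now apply Hmax|].
  destruct (Rle_lt_or_eq_dec _ _ Hz0) as [Hlt | Heq].
  2: { rewrite Ez, Heq. lra. }
  set (s := r - Cmod z0). assert (Hs : 0 < s) by (unfold s; lra).
  assert (HD : forall t, cdisc r (z0 + circ s t)%C).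
  { intros t'. unfold cdisc. eapply Rle_trans; [apply Cmod_triangle|].
    rewrite Cmod_circ by lra. unfold s; lra. }
  replace (circ r t) with (z0 + circ s t)%C.
  - right; symmetry.
    apply (avg_max_eq (fun t => U (z0 + circ s t)%C)); [| | |lra].
    + apply (cont_rcont (cdisc r)); auto; lra.
    + intros t'. now apply Hmax.
    + apply Hsub; unfold s in *; lra.
  - rewrite Ez at 1. rewrite (circ_plus r), (circ_plus s), (circ_plus (Cmod z0)).
    unfold s. rewrite RtoC_minus. ring.
Qed.

Lemma riemann_sum_avg g n e : cont g ->
  (forall s t, Rabs (t - s) <= 2 * PI / INR (S n) -> Rabs (g t - g s) <= e) ->
  Rabs (avg g - sum_f_R0 (fun j => g (2 * PI * INR j / INR (S n))) n / INR (S n)) <= e.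
Proof.
  intros Hg He. pose proof two_PI_pos as Hpi.
  assert (HN : 0 < INR (S n)) by apply lt_0_INR, Nat.lt_0_succ.
  set (N := INR (S n)) in *. set (tau := 2 * PI / N).
  assert (Htau : 0 < tau) by now apply Rdiv_lt_0_compat.
  assert (H : forall m, Rabs (RInt g 0 (INR (S m) * tau)
      - tau * sum_f_R0 (fun j => g (2 * PI * INR j / N)) m) <= e * (INR (S m) * tau)).
  { assert (Hstep : forall m, Rabs (RInt g (INR m * tau) (INR (S m) * tau)
       - tau * g (2 * PI * INR m / N)) <= e * tau).
    { intros m. replace (2 * PI * INR m / N) with (INR m * tau) by (unfold tau; field; lra).
      pose proof (RInt_near_const g (INR m * tau) (INR (S m) * tau) (g (INR m * tau)) e) as R.
      replace (INR (S m) * tau - INR m * tau) with tau in R by (rewrite S_INR; ring).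
      rewrite (Rmult_comm tau). apply R.
      - rewrite S_INR; lra.
      - now apply cont_ex_RInt.
      - intros t Ht. rewrite S_INR in Ht. apply He. fold tau. apply Rabs_le. lra. }
    induction m as [|m IH].
    - specialize (Hstep 0%nat). change (INR 0) with 0 in Hstep.
      rewrite Rmult_0_l in Hstep. simpl sum_f_R0. change (INR 1) with 1 in *.
      rewrite Rmult_1_l in *. exact Hstep.
    - specialize (Hstep (S m)).
      rewrite <- (RInt_Chasles g 0 (INR (S m) * tau)) by now apply cont_ex_RInt.
      rewrite tech5. cbv beta.
      match goal with |- context [plus ?x ?y] => change (plus x y) with (x + y) end.
      replace (e * (INR (S (S m)) * tau)) with (e * (INR (S m) * tau) + e * tau)
        by (rewrite (S_INR (S m)); ring).
      apply Rabs_le_between in IH, Hstep. apply Rabs_le. lra. }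
  specialize (H n). fold N in H. replace (N * tau) with (2 * PI) in H by (unfold tau; field; lra).
  unfold avg. set (I := RInt g 0 (2 * PI)) in *. set (S := sum_f_R0 _ n) in *.
  replace (I / (2 * PI) - S / N) with ((I - tau * S) / (2 * PI))
    by (unfold tau; field; lra).
  rewrite Rabs_div, (Rabs_pos_eq (2 * PI)) by lra.
  apply Rle_div_l; lra.
Qed.

Lemma Mp_avg p f r : Mp p f r = avg (fun t => rpow (Cmod (f (circ r t))) p).
Proof. reflexivity. Qed.

Lemma cont_Mp p f r : 0 < p -> holo_D f -> 0 <= r < 1 ->
  cont (fun t => rpow (Cmod (f (circ r t))) p).
Proof.
  intros Hp Hf Hr. apply (cont_circ inD (fun z => rpow (Cmod (f z)) p)); [lra| |].
  - intros t. now apply inD_circ.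
  - intros z Hz. apply rcont_Cmod_rpow; [assumption | now apply holo_ccont].
Qed.

Lemma sum_f_R0_scal c u n : sum_f_R0 (fun k => c * u k) n = c * sum_f_R0 u n.
Proof. induction n; simpl; [ring|]. rewrite IHn; ring. Qed.

(* The maximum principle applied to averages of [|f|^p] over finite groups of rotations;
   on a circle of radius [r] these converge uniformly to [Mp p f r]. *)
Lemma Mp_monotone p f r r' : 1 < p -> holo_D f -> 0 <= r <= r' -> r' < 1 ->
  Mp p f r <= Mp p f r'.
Proof.
  intros Hp Hf Hr Hr'.
  destruct (Rle_lt_or_eq_dec 0 r') as [Hr0 | <-]; [lra| |replace r with 0 by lra; lra].
  apply Rle_plus_epsilon. intros eps He.
  set (u := fun z => rpow (Cmod (f z)) p).
  assert (Hu : forall z, inD z -> rcont inD u z).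
  { intros z Hz. apply rcont_Cmod_rpow; [lra | now apply holo_ccont]. }
  assert (HdD : forall z, cdisc r' z -> inD z) by (intros z Hz; unfold cdisc, inD in *; lra).
  destruct (cdisc_uniform_R r' u) with (eps := eps / 2) as [d [Hd Hunif]]; [|lra|].
  { intros z Hz. apply vanishes_subset with inD; [exact HdD|]. now apply Hu, HdD. }
  destruct (nfloor_ex (2 * (2 * PI) / d)) as [n [_ Hn]].
  { pose proof two_PI_pos. apply Rdiv_le_0_compat; lra. }
  rewrite <- S_INR in Hn. set (N := INR (S n)) in *.
  assert (HN : 0 < N) by apply lt_0_INR, Nat.lt_0_succ.
  apply Rlt_div_l in Hn; [|assumption].
  set (om := fun j => 2 * PI * INR j / N).
  (* The offset [a] is arbitrary because the maximum principle does not control the angle at which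
     the outer circle dominates. *)
  assert (Hriem : forall s a, 0 <= s <= r' -> Rabs (Mp p f s
     - sum_f_R0 (fun j => u (circ s (a + om j))) n / N) <= eps / 2).
  { intros s a Hs. rewrite Mp_avg.
    rewrite <- (avg_shift _ a) by
      (try (apply cont_Mp; lra || assumption); intros t; now rewrite circ_period).
    apply (riemann_sum_avg (fun t => u (circ s (a + t)))).
    - assert (Hc : cont (fun t => u (circ s t))) by (apply cont_Mp; lra || assumption).
      intros t. apply (continuous_comp (fun t => a + t) (fun t => u (circ s t))); [|apply Hc].
      apply (cont_plus (fun _ => a) (fun t => t)); [apply cont_const|].
      intros t'. apply continuous_id.
    - intros x y Hxy. fold N in Hxy. left. apply Hunif.
      + unfold cdisc. rewrite Cmod_circ; lra.
      + unfold cdisc. rewrite Cmod_circ; lra.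
      + eapply Rle_lt_trans; [apply Cmod_circ_sub; lra|].
        replace (a + y - (a + x)) with (y - x) by ring.
        apply Rle_lt_trans with (2 * (2 * PI / N)).
        * pose proof (Rabs_pos (y - x)). nra.
        * replace (2 * (2 * PI / N)) with (2 * (2 * PI) / N) by (field; lra).
          apply Rlt_div_l; lra. }
  set (U := fun z => / N * sum_f_R0 (fun j => u (z * circ 1 (om j))%C) n).
  assert (Hrot : forall j z, Cmod (z * circ 1 (om j))%C = Cmod z).
  { intros j z. rewrite Cmod_mult, Cmod_circ by lra. ring. }
  assert (Hrotf : forall j, holo_D (fun z => f (z * circ 1 (om j))%C)).
  { intros j. apply holo_cdiff. intros z Hz.
    apply (cdiff_comp f (fun z => z * circ 1 (om j))%C).
    - intros w Hw. unfold inD. now rewrite Hrot.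
    - apply cdiff_mult; [apply cdiff_id | apply cdiff_const].
    - apply holo_cdiff; [assumption|]. unfold inD. now rewrite Hrot. }
  assert (HUcirc : forall s t, U (circ s t) = sum_f_R0 (fun j => u (circ s (t + om j))) n / N).
  { intros s t. unfold U, Rdiv. rewrite Rmult_comm. f_equal.
    apply sum_eq. intros j _. now rewrite circ_mult, Rmult_1_r. }
  destruct (max_principle U r' Hr0) with (z := circ r 0) as [t Ht].
  - intros z Hz. apply rcont_scal, rcont_sum. intros j.
    apply vanishes_subset with inD; [exact HdD|].
    apply (rcont_Cmod_rpow inD (fun z => f (z * circ 1 (om j))%C)); [lra|].
    apply holo_ccont; auto.
  - intros z s Hs Hzs.
    assert (Hcj : forall j, cont (fun t => u ((z + circ s t) * circ 1 (om j))%C)).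
    { intros j. apply (cont_pow_circ (fun z => f (z * circ 1 (om j))%C)); auto; lra. }
    unfold U. rewrite avg_scal by now apply cont_sum.
    apply Rmult_le_compat_l; [left; now apply Rinv_0_lt_compat|].
    rewrite avg_sum by assumption.
    apply sum_Rle. intros j _.
    apply (sub_mean_value (fun z => f (z * circ 1 (om j))%C)); auto. lra.
  - unfold cdisc. rewrite Cmod_circ; lra.
  - rewrite !HUcirc in Ht.
    pose proof (Hriem r 0 Hr) as A1. pose proof (Hriem r' t ltac:(lra)) as A2.
    apply Rabs_le_between in A1, A2. lra.
Qed.

(** * Uniform convexity and convergence of dilations *)

Definition mid (a b : C) : C := (RtoC (1 / 2) * (a + b))%C.

Definition convexity_gap (p : R) (a b : C) : R :=
  (rpow (Cmod a) p + rpow (Cmod b) p) / 2 - rpow (Cmod (mid a b)) p.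

(** The deviations of [a] and [b] from their midpoint are opposite, so the linear terms cancel when
    the two tangent inequalities at the midpoint are added. *)
Lemma convexity_gap_tangents p a b :
  let m := mid a b in let k := p * rpow (Cmod m) (p - 2) in
  k * fst (Cconj m * (a - m))%C + k * fst (Cconj m * (b - m))%C = 0.
Proof. intros m k. unfold m, mid. simpl. field. Qed.

Lemma convexity_gap_ge_0 p a b : 1 < p -> 0 <= convexity_gap p a b.
Proof.
  intros Hp. pose proof (convexity_gap_tangents p a b) as E. cbv zeta in E.
  pose proof (Cmod_tangent p (mid a b) a Hp). pose proof (Cmod_tangent p (mid a b) b Hp).
  unfold convexity_gap. lra.
Qed.

Lemma convexity_gap_gt_0 p a b : 1 < p -> a <> b -> 0 < convexity_gap p a b.
Proof.
  intros Hp Hab. pose proof (convexity_gap_tangents p a b) as E. cbv zeta in E.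
  assert (Ha : a <> mid a b).
  { intros E1. apply Hab. assert (E2 : (RtoC 2 * mid a b = a + b)%C).
    { unfold mid. rewrite Cmult_assoc, <- RtoC_mult. replace (2 * (1 / 2)) with 1 by field. ring. }
    rewrite <- E1 in E2. replace a with (RtoC 2 * a - a)%C by (change (RtoC 2) with (RtoC (1 + 1));
      rewrite RtoC_plus; ring). rewrite E2. ring. }
  pose proof (Cmod_tangent_lt p (mid a b) a Hp Ha). pose proof (Cmod_tangent p (mid a b) b Hp).
  unfold convexity_gap. lra.
Qed.

Lemma convexity_gap_scal p c a b :
  convexity_gap p (c * a)%C (c * b)%C = rpow (Cmod c) p * convexity_gap p a b.
Proof.
  unfold convexity_gap. replace (mid (c * a)%C (c * b)%C) with (c * mid a b)%C
    by (unfold mid; ring).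
  rewrite !Cmod_mult, !rpow_mult by apply Cmod_ge_0. lra.
Qed.

Lemma convexity_gap_sym p a b : convexity_gap p a b = convexity_gap p b a.
Proof.
  unfold convexity_gap. replace (mid b a) with (mid a b) by (unfold mid; ring). lra.
Qed.

(** A compactness argument: [u], the gap plus the positive part of [eps - |1 - z|^p], is continuous
    and positive on the closed disc, since the second term is [eps] at [z = 1] and the gap is
    positive elsewhere. Where [|1 - z|^p > eps], the gap alone is at least the minimum [u z0], while
    [|1 - z|^p <= 2^p]; hence [K = 2^p / u z0]. *)
Lemma uniform_convexity_disc p eps : 1 < p -> 0 < eps -> exists K, 0 < K /\
  forall z, cdisc 1 z -> rpow (Cmod (1 - z)) p <= eps + K * convexity_gap p 1 z.
Proof.
  intros Hp He.
  set (g := fun z : C => rpow (Cmod (1 - z)) p).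
  set (u := fun z => convexity_gap p 1 z + Rmax 0 (eps - g z)).
  assert (Hg : forall z, rcont (cdisc 1) g z).
  { intros z. apply (rcont_Cmod_rpow _ (fun z => 1 - z)%C); [lra|].
    apply (ccont_plus _ (fun _ => RtoC 1) (fun z => - z)%C); [apply ccont_const|].
    eapply vanishes_le; [|apply ccont_id]. intros w _.
    replace (- w - - z)%C with (- (w - z))%C by ring. rewrite Cmod_opp. apply Rle_refl. }
  destruct (cdisc_max 1 (fun z => - 1 * u z)) as [z0 [_ Hmin]]; [lra| |].
  { intros z _. apply rcont_scal, rcont_plus.
    - unfold convexity_gap.
      apply vanishes_le with (fun w => Rabs ((1 / 2 * rpow (Cmod w) p + -1 * rpow (Cmod (mid 1 w)) p)
        - (1 / 2 * rpow (Cmod z) p + -1 * rpow (Cmod (mid 1 z)) p))).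
      { intros w _. right; f_equal. field. }
      apply (rcont_plus _ (fun w => 1 / 2 * rpow (Cmod w) p)); apply rcont_scal.
      + apply (rcont_Cmod_rpow _ (fun w => w)); [lra | apply ccont_id].
      + apply rcont_Cmod_rpow; [lra|]. unfold mid. apply ccont_mult; [apply ccont_const|].
        apply ccont_plus; [apply ccont_const | apply ccont_id].
    - eapply vanishes_le; [|apply (Hg z)]. intros w _. cbv beta.
      unfold Rmax. destruct (Rle_dec 0 (eps - g w)), (Rle_dec 0 (eps - g z));
        unfold Rabs; repeat destruct Rcase_abs; lra. }
  assert (Hu0 : 0 < u z0).
  { unfold u. pose proof (Rmax_l 0 (eps - g z0)). pose proof (Rmax_r 0 (eps - g z0)).
    destruct (classic (RtoC 1 = z0)) as [E | Hn].
    - assert (g z0 = 0) by (unfold g; rewrite E, Cmod_0_sub; apply rpow_0).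
      pose proof (convexity_gap_ge_0 p 1 z0 Hp). lra.
    - pose proof (convexity_gap_gt_0 p 1 z0 Hp Hn). lra. }
  assert (H2 : 0 < rpow 2 p) by (apply rpow_gt_0; lra).
  exists (rpow 2 p / u z0). split; [now apply Rdiv_lt_0_compat|].
  intros z Hz. specialize (Hmin z Hz). unfold u at 1 in Hmin.
  pose proof (convexity_gap_ge_0 p 1 z Hp) as H0.
  assert (Hc : 0 < rpow 2 p / u z0) by now apply Rdiv_lt_0_compat.
  destruct (Rle_dec (g z) eps) as [Hle | Hgt]; [fold (g z); nra|].
  rewrite Rmax_left in Hmin by lra.
  apply Rle_trans with (rpow 2 p).
  - apply rpow_le; [lra|]. split; [apply Cmod_ge_0|].
    eapply Rle_trans; [apply Cmod_sub_le|]. rewrite Cmod_1. unfold cdisc in Hz. lra.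
  - replace (rpow 2 p) with (rpow 2 p / u z0 * u z0) at 1 by (field; lra). nra.
Qed.

(** Both sides are homogeneous of degree [p], so division by the number of larger modulus reduces to
    the pair [1], [z] in the closed disc. *)
Lemma uniform_convexity p eps : 1 < p -> 0 < eps -> exists K, 0 < K /\
  forall a b : C, rpow (Cmod (a - b)) p
    <= eps * (rpow (Cmod a) p + rpow (Cmod b) p) + K * convexity_gap p a b.
Proof.
  intros Hp He. destruct (uniform_convexity_disc p eps Hp He) as [K [HK H]].
  exists K; split; [assumption|].
  assert (Hw : forall a b : C, Cmod b <= Cmod a -> rpow (Cmod (a - b)) p
    <= eps * rpow (Cmod a) p + K * convexity_gap p a b).
  { intros a b Hab. destruct (classic (a = 0%C)) as [-> | Ha].
    - rewrite Cmod_0 in Hab. assert (b = 0%C) as ->.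
      { apply Cmod_eq_0. pose proof (Cmod_ge_0 b). lra. }
      pose proof (convexity_gap_ge_0 p 0 0 Hp).
      rewrite Cmod_0_sub, Cmod_0, rpow_0. nra.
    - assert (Hm : 0 < Cmod a) by now apply Cmod_gt_0.
      assert (Hz : cdisc 1 (b / a)%C).
      { unfold cdisc. rewrite Cmod_div by assumption. apply Rle_div_l; lra. }
      specialize (H _ Hz).
      replace (a - b)%C with (a * (1 - b / a))%C by (field; assumption).
      replace (convexity_gap p a b) with (convexity_gap p (a * 1)%C (a * (b / a))%C)
        by (f_equal; field; assumption).
      rewrite convexity_gap_scal, Cmod_mult, rpow_mult by apply Cmod_ge_0.
      pose proof (rpow_gt_0 _ p Hm). nra. }
  intros a b. pose proof (rpow_ge_0 (Cmod a) p). pose proof (rpow_ge_0 (Cmod b) p).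
  destruct (Rle_dec (Cmod b) (Cmod a)) as [Hle | Hgt].
  - specialize (Hw a b Hle). nra.
  - specialize (Hw b a ltac:(lra)). rewrite Cmod_sub_sym, convexity_gap_sym. nra.
Qed.

(** * Dilations and their convergence in the mean *)

Definition dil (rho : R) (f : C -> C) (z : C) : C := f (RtoC rho * z)%C.

Lemma inD_dil rho z : 0 <= rho <= 1 -> inD z -> inD (RtoC rho * z)%C.
Proof.
  unfold inD. intros Hr Hz. rewrite Cmod_mult, Cmod_R, Rabs_pos_eq by lra.
  pose proof (Cmod_ge_0 z). nra.
Qed.

Lemma holo_dil rho f : 0 <= rho <= 1 -> holo_D f -> holo_D (dil rho f).
Proof.
  intros Hr Hf. apply holo_cdiff. intros z Hz.
  apply (cdiff_comp f (fun z => RtoC rho * z)%C).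
  - intros w. now apply inD_dil.
  - apply cdiff_mult; [apply cdiff_const | apply cdiff_id].
  - apply holo_cdiff; [assumption | now apply inD_dil].
Qed.

Lemma holo_mult f g : holo_D f -> holo_D g -> holo_D (fun z => f z * g z)%C.
Proof. rewrite !holo_cdiff. intros Hf Hg z Hz. apply cdiff_mult; auto. Qed.

Lemma holo_plus f g : holo_D f -> holo_D g -> holo_D (fun z => f z + g z)%C.
Proof. rewrite !holo_cdiff. intros Hf Hg z Hz. apply cdiff_plus; auto. Qed.

Lemma holo_const c : holo_D (fun _ => c).
Proof. apply holo_cdiff. intros z _. apply cdiff_const. Qed.

Lemma cdiff_ext f g z : (forall w, f w = g w) -> cdiff f z -> cdiff g z.
Proof.
  intros E [a [Ha H]]. exists a; split; [assumption|]. intros w. rewrite <- !E. apply H.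
Qed.

Lemma holo_minus f g : holo_D f -> holo_D g -> holo_D (fun z => f z - g z)%C.
Proof.
  rewrite !holo_cdiff. intros Hf Hg z Hz.
  apply cdiff_ext with (fun w => f w + - (1) * g w)%C; [intros; ring|].
  apply cdiff_plus; [auto|]. apply cdiff_mult; [apply cdiff_const | auto].
Qed.

Lemma Mp_dil p f rho r : Mp p (dil rho f) r = Mp p f (rho * r).
Proof.
  rewrite !Mp_avg. apply avg_ext. intros t. unfold dil.
  rewrite (circ_plus r), (circ_plus (rho * r)), RtoC_mult. do 3 f_equal. ring.
Qed.

Lemma Mp_ge_0 p f r : 0 < p -> holo_D f -> 0 <= r < 1 -> 0 <= Mp p f r.
Proof.
  intros Hp Hf Hr. rewrite Mp_avg. apply avg_ge_const; [now apply cont_Mp|].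
  intros t. apply rpow_ge_0.
Qed.

Lemma Cmod_tangent_abs p (a w : C) : 1 < p ->
  rpow (Cmod a) p - p * rpow (Cmod a) (p - 1) * Cmod (w - a) <= rpow (Cmod w) p.
Proof.
  intros Hp. destruct (classic (a = 0%C)) as [-> | Ha].
  { rewrite Cmod_0, !rpow_0. pose proof (rpow_ge_0 (Cmod w) p). lra. }
  apply Cmod_gt_0 in Ha.
  destruct (Rle_dec (Cmod a) (Cmod w)) as [Hle | Hgt].
  - pose proof (rpow_le (Cmod a) (Cmod w) p ltac:(lra) ltac:(lra)).
    pose proof (rpow_ge_0 (Cmod a) (p - 1)). pose proof (Cmod_ge_0 (w - a)).
    assert (0 <= p * rpow (Cmod a) (p - 1)) by nra. nra.
  - pose proof (rpow_tangent p (Cmod a) (Cmod w) Hp Ha (Cmod_ge_0 w)).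
    pose proof (rpow_ge_0 (Cmod a) (p - 1)).
    pose proof (Cmod_le_sub a w). rewrite Cmod_sub_sym in H1.
    assert (0 <= p * rpow (Cmod a) (p - 1)) by nra. nra.
Qed.

(** Take [r0] with mean of [f] close to [S]. On that circle the dilation is uniformly close to [f],
    so the midpoint [m] of the two still has mean at least [S - 2 * eta], and by monotonicity so it
    does on every larger circle. There [f] and its dilation have means at most [S], so the mean
    convexity gap is at most [2 * eta] and uniform convexity makes the difference small. Smaller
    circles follow by monotonicity for the difference itself. *)
Lemma dil_converges p f S : 1 < p -> holo_D f ->
  (forall r, 0 <= r < 1 -> Mp p f r <= S) ->
  (forall eta, 0 < eta -> exists r, 0 <= r < 1 /\ S - eta < Mp p f r) ->
  forall eps, 0 < eps -> exists rho1, 0 <= rho1 < 1 /\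
    forall rho r, rho1 <= rho < 1 -> 0 <= r < 1 ->
      Mp p (fun z => f z - dil rho f z)%C r <= eps.
Proof.
  intros Hp Hf HS Hlub eps He.
  assert (HS0 : 0 <= S).
  { eapply Rle_trans; [|apply (HS 0); lra]. apply Mp_ge_0; lra || assumption. }
  (* Half of [eps] pays for [e1 * (2 * S)], the other half for [K * (2 * eta)]. *)
  set (e1 := eps / (4 * (S + 1))).
  assert (He1 : 0 < e1) by (apply Rdiv_lt_0_compat; lra).
  destruct (uniform_convexity p e1 Hp He1) as [K [HK Huc]].
  set (eta := eps / (4 * K)).
  assert (Heta : 0 < eta) by (apply Rdiv_lt_0_compat; lra).
  destruct (Hlub eta Heta) as [r0 [Hr0 HMr0]].
  assert (HcD : forall z, cdisc r0 z -> ccont (cdisc r0) f z).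
  { intros z Hz. apply vanishes_subset with inD.
    - intros w Hw. unfold cdisc, inD in *; lra.
    - apply holo_ccont; [assumption|]. unfold cdisc, inD in *; lra. }
  destruct (cdisc_bounded r0 (fun z => Cmod (f z)) ltac:(lra)) as [B HB].
  { intros z Hz. now apply rcont_Cmod, HcD. }
  assert (HB0 : 0 <= B).
  { eapply Rle_trans; [|apply (HB 0%C)]; [apply Rabs_pos|]. unfold cdisc. rewrite Cmod_0; lra. }
  (* A bound for the slope [p |f|^(p-1)] on the disc of radius [r0]; [B + 1] instead of [B] keeps it
     positive. *)
  set (q := p * rpow (B + 1) (p - 1)).
  assert (Hq : 0 < q) by (apply Rmult_lt_0_compat; [lra | apply rpow_gt_0; lra]).
  destruct (cdisc_uniform_C r0 f HcD (eta / q)) as [d [Hd Hunif]];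
    [now apply Rdiv_lt_0_compat|].
  exists (Rmax 0 (1 - d / 2)).
  split; [split; [apply Rmax_l | apply Rmax_lub_lt; lra]|].
  intros rho r Hrho Hr.
  pose proof (Rmax_l 0 (1 - d / 2)). pose proof (Rmax_r 0 (1 - d / 2)).
  assert (Hg : holo_D (dil rho f)) by (apply holo_dil; lra || assumption).
  set (F := fun z => (f z - dil rho f z)%C).
  assert (HF : holo_D F) by now apply holo_minus.
  set (m := fun z => mid (f z) (dil rho f z)).
  assert (Hm : holo_D m).
  { apply (holo_mult (fun _ => RtoC (1 / 2))); [apply holo_const | now apply holo_plus]. }
  assert (Hmr0 : S - 2 * eta <= Mp p m r0).
  { apply Rle_trans with (avg (fun t => rpow (Cmod (f (circ r0 t))) p + - eta)).
    - rewrite avg_plus, avg_const, <- Mp_avg by (apply cont_const || (apply cont_Mp; lra || assumption)).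
      lra.
    - rewrite Mp_avg. apply avg_le.
      + apply cont_plus; [apply cont_Mp; lra || assumption | apply cont_const].
      + apply cont_Mp; lra || assumption.
      + intros t. set (z := circ r0 t).
        assert (Hz : cdisc r0 z) by (unfold cdisc, z; rewrite Cmod_circ; lra).
        assert (Hz' : cdisc r0 (RtoC rho * z)%C).
        { unfold cdisc in *. rewrite Cmod_mult, Cmod_R, Rabs_pos_eq by lra.
          pose proof (Cmod_ge_0 z). nra. }
        assert (Hdz : Cmod (RtoC rho * z - z) < d).
        { replace (RtoC rho * z - z)%C with (RtoC (rho - 1) * z)%C by (rewrite RtoC_minus; ring).
          rewrite Cmod_mult, Cmod_R, Rabs_left by lra. unfold cdisc in Hz.
          pose proof (Cmod_ge_0 z). nra. }
        specialize (Hunif z _ Hz Hz' Hdz). fold (dil rho f z) in Hunif.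
        pose proof (Cmod_tangent_abs p (f z) (m z) Hp) as Ht.
        replace (m z - f z)%C with (RtoC (1 / 2) * (dil rho f z - f z))%C in Ht.
        2: { unfold m, mid. replace (f z) with (RtoC (1 / 2) * (f z + f z))%C at 3; [ring|].
             replace (f z + f z)%C with (RtoC 2 * f z)%C
               by (change (RtoC 2) with (RtoC (1 + 1)); rewrite RtoC_plus; ring).
             rewrite Cmult_assoc, <- RtoC_mult. replace (1 / 2 * 2) with 1 by field. ring. }
        rewrite Cmod_mult, Cmod_R, Rabs_pos_eq in Ht by lra.
        assert (Hqz : p * rpow (Cmod (f z)) (p - 1) <= q).
        { apply Rmult_le_compat_l; [lra|]. apply rpow_le; [lra|].
          specialize (HB z Hz). rewrite Rabs_pos_eq in HB by apply Cmod_ge_0.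
          pose proof (Cmod_ge_0 (f z)). lra. }
        apply Rlt_div_r in Hunif; [|assumption].
        pose proof (Cmod_ge_0 (dil rho f z - f z)).
        assert (0 <= p * rpow (Cmod (f z)) (p - 1)).
        { apply Rmult_le_pos; [lra | apply rpow_ge_0]. }
        nra. }
  assert (Hbig : forall s, r0 <= s < 1 -> Mp p F s <= eps).
  { intros s Hs.
    assert (Hms : S - 2 * eta <= Mp p m s).
    { eapply Rle_trans; [exact Hmr0|]. apply Mp_monotone; lra || assumption. }
    pose proof (HS s ltac:(lra)) as Hfs.
    assert (Hgs : Mp p (dil rho f) s <= S) by (rewrite Mp_dil; apply HS; nra).
    assert (Cf : cont (fun t => rpow (Cmod (f (circ s t))) p)) by (apply cont_Mp; lra || assumption).
    assert (Cg : cont (fun t => rpow (Cmod (dil rho f (circ s t))) p))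
      by (apply cont_Mp; lra || assumption).
    assert (Cm : cont (fun t => rpow (Cmod (m (circ s t))) p)) by (apply cont_Mp; lra || assumption).
    assert (HM : Mp p F s <= (e1 + K / 2) * (Mp p f s + Mp p (dil rho f) s) + - K * Mp p m s).
    { rewrite !(Mp_avg p). rewrite <- avg_plus, <- !avg_scal, <- avg_plus by
        repeat (assumption || apply cont_plus || apply cont_scal).
      apply avg_le.
      - apply cont_Mp; lra || assumption.
      - repeat (assumption || apply cont_plus || apply cont_scal).
      - intros t. pose proof (Huc (f (circ s t)) (dil rho f (circ s t))) as Ht.
        unfold convexity_gap in Ht. fold (m (circ s t)) in Ht.
        unfold F. lra. }
    assert (e1 * (2 * S) <= eps / 2).
    { unfold e1. replace (eps / (4 * (S + 1)) * (2 * S)) with (eps / 2 * (S / (S + 1))) by (field; lra).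
      assert (S / (S + 1) <= 1) by (apply Rle_div_l; lra). nra. }
    assert (K * (2 * eta) = eps / 2) by (unfold eta; field; lra).
    assert ((e1 + K / 2) * (Mp p f s + Mp p (dil rho f) s) <= (e1 + K / 2) * (2 * S))
      by (apply Rmult_le_compat_l; lra).
    assert (K * (S - 2 * eta) <= K * Mp p m s) by (apply Rmult_le_compat_l; lra).
    nra. }
  destruct (Rle_dec r0 r) as [Hle | Hgt]; [apply Hbig; lra|].
  apply Rle_trans with (Mp p F r0); [|apply Hbig; lra].
  apply Mp_monotone; lra || assumption.
Qed.

(** * The Hardy norm in terms of integral means *)

Lemma in_Hp_intro p f B : 1 < p -> holo_D f -> 0 <= B ->
  (forall r, 0 <= r < 1 -> Mp p f r <= rpow B p) -> in_Hp p f /\ Hp_norm p f <= B.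
Proof.
  intros Hp Hf HB H.
  destruct (Lub_Rbar_correct (fun y => exists r, 0 <= r < 1 /\ y = rpow (Mp p f r) (1 / p)))
    as [Hub Hleast].
  fold (Hp_sup p f) in Hub, Hleast.
  assert (H1 : Rbar_le (Hp_sup p f) B).
  { apply Hleast. intros y [r [Hr ->]]. simpl.
    rewrite <- (rpow_root B p) by lra. apply rpow_le; [apply Rdiv_lt_0_compat; lra|].
    split; [apply Mp_ge_0; lra || assumption | now apply H]. }
  (* The radius 0 provides a finite lower bound, which excludes the value [m_infty]. *)
  assert (H2 : Rbar_le (rpow (Mp p f 0) (1 / p)) (Hp_sup p f)).
  { apply Hub. exists 0. split; [lra | reflexivity]. }
  unfold in_Hp, Hp_norm, is_finite.
  destruct (Hp_sup p f); simpl in *; [auto | contradiction..].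
Qed.

Lemma Mp_le_norm p f r : 1 < p -> in_Hp p f -> 0 <= r < 1 ->
  Mp p f r <= rpow (Hp_norm p f) p.
Proof.
  intros Hp [Hf Hfin] Hr.
  destruct (Lub_Rbar_correct (fun y => exists r, 0 <= r < 1 /\ y = rpow (Mp p f r) (1 / p)))
    as [Hub _].
  fold (Hp_sup p f) in Hub.
  assert (H2 : Rbar_le (rpow (Mp p f r) (1 / p)) (Hp_sup p f)) by (apply Hub; now exists r).
  unfold Hp_norm. rewrite <- Hfin in H2. simpl in H2.
  assert (H0 : 0 <= Mp p f r) by (apply Mp_ge_0; lra || assumption).
  rewrite <- (root_rpow (Mp p f r) p) by lra.
  apply rpow_le; [lra|]. split; [apply rpow_ge_0 | exact H2].
Qed.

Lemma Hp_norm_ge_0 p f : 1 < p -> in_Hp p f -> 0 <= Hp_norm p f.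
Proof.
  intros Hp [Hf Hfin].
  destruct (Lub_Rbar_correct (fun y => exists r, 0 <= r < 1 /\ y = rpow (Mp p f r) (1 / p)))
    as [Hub _].
  fold (Hp_sup p f) in Hub.
  assert (H2 : Rbar_le (rpow (Mp p f 0) (1 / p)) (Hp_sup p f)).
  { apply Hub. exists 0. split; [lra | reflexivity]. }
  unfold Hp_norm. rewrite <- Hfin in H2. simpl in H2.
  pose proof (rpow_ge_0 (Mp p f 0) (1 / p)). lra.
Qed.

Lemma Mp_lt_norm p f x : 1 < p -> in_Hp p f -> 0 <= x < Hp_norm p f ->
  exists r, 0 <= r < 1 /\ rpow x p < Mp p f r.
Proof.
  intros Hp Hf Hx. apply NNPP; intros Hn.
  destruct (in_Hp_intro p f x Hp (proj1 Hf) (proj1 Hx)) as [_ H]; [|lra].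
  intros r Hr. apply Rnot_lt_le. intros Hlt. apply Hn. now exists r.
Qed.

Lemma dil_converges_Hp p f eps : 1 < p -> in_Hp p f -> 0 < eps ->
  exists rho1, 0 <= rho1 < 1 /\ forall rho r, rho1 <= rho < 1 -> 0 <= r < 1 ->
      Mp p (fun z => f z - dil rho f z)%C r <= eps.
Proof.
  intros Hp Hf He. apply dil_converges with (rpow (Hp_norm p f) p); auto.
  - apply Hf.
  - intros r Hr. now apply Mp_le_norm.
  - intros eta Heta. apply NNPP; intros Hn.
    set (S := rpow (Hp_norm p f) p) in *.
    assert (Hle : forall r, 0 <= r < 1 -> Mp p f r <= S - eta).
    { intros r Hr. apply Rnot_lt_le. intros Hlt. apply Hn. now exists r. }
    assert (H0 : 0 <= S - eta).
    { eapply Rle_trans; [|apply (Hle 0); lra]. apply Mp_ge_0; [lra | apply Hf | lra]. }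
    destruct (in_Hp_intro p f (rpow (S - eta) (1 / p)) Hp (proj1 Hf) (rpow_ge_0 _ _)) as [_ H].
    { intros r Hr. rewrite root_rpow by lra. now apply Hle. }
    pose proof (Hp_norm_ge_0 p f Hp Hf) as H1.
    pose proof (rpow_le _ _ p ltac:(lra) (conj H1 H)) as H2.
    rewrite root_rpow in H2 by lra. fold S in H2. lra.
Qed.

(** * Reproducing kernels at equidistributed points *)

(** [cdiff] asks for its factorisation at every complex [w], whereas that of a kernel is available
    only where the denominator is nonzero. Outside the disc the difference quotient serves, and
    continuity relative to the disc does not see it. *)
Lemma cdiff_local f phi z : inD z -> ccont inD phi z ->
  (forall w, inD w -> f w = (f z + phi w * (w - z))%C) -> cdiff f z.
Proof.
  intros Hz Hphi E.
  exists (fun w => if excluded_middle_informative (inD w) then phi w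
                   else ((f w - f z) / (w - z))%C).
  split.
  - eapply vanishes_le; [|exact Hphi]. intros w Hw. cbv beta.
    destruct (excluded_middle_informative (inD w)); [|contradiction].
    destruct (excluded_middle_informative (inD z)); [|contradiction]. apply Rle_refl.
  - intros w. destruct (excluded_middle_informative (inD w)) as [Hw | Hw]; [now apply E|].
    field. intros E0. apply Hw. replace w with (w - z + z)%C by ring. rewrite E0.
    now rewrite Cplus_0_l.
Qed.

Lemma kernel_den_ge lam z : Cmod z <= 1 -> 1 - Cmod lam <= Cmod (1 - Cconj lam * z).
Proof.
  intros Hz. pose proof (Cmod_le_sub 1 (Cconj lam * z)) as H.
  rewrite Cmod_1, Cmod_mult, Cmod_conj in H.
  pose proof (Cmod_ge_0 lam). pose proof (Cmod_ge_0 z). nra.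
Qed.

Lemma kernel_den_neq_0 lam z : inD lam -> Cmod z <= 1 -> (1 - Cconj lam * z)%C <> 0.
Proof.
  unfold inD. intros Hl Hz. apply Cmod_gt_0. pose proof (kernel_den_ge lam z Hz). lra.
Qed.

Lemma holo_kernel lam : inD lam -> holo_D (kernel lam).
Proof.
  intros Hl. apply holo_cdiff. intros z Hz. unfold inD in Hz.
  pose proof (kernel_den_neq_0 lam z Hl ltac:(lra)) as Hd.
  apply cdiff_local with (fun w => Cconj lam * kernel lam z * kernel lam w)%C; [assumption| |].
  - apply ccont_mult; [apply ccont_const|].
    apply (ccont_comp inD (fun _ => True) Cinv (fun w => 1 - Cconj lam * w)%C);
      [trivial | | now apply ccont_inv].
    apply (ccont_plus inD (fun _ => RtoC 1) (fun w => - (Cconj lam * w))%C);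
      [apply ccont_const|].
    apply vanishes_le with (fun w => Cmod (Cconj lam * w - Cconj lam * z)).
    + intros w _. rewrite <- Cmod_opp. right; f_equal. ring.
    + apply (ccont_mult inD (fun _ => Cconj lam) (fun w => w)); [apply ccont_const | apply ccont_id].
  - intros w Hw. unfold inD in Hw.
    pose proof (kernel_den_neq_0 lam w Hl ltac:(lra)) as Hd'.
    unfold kernel. field. auto.
Qed.

Lemma kernel_in_Hp p lam : 1 < p -> inD lam -> in_Hp p (kernel lam).
Proof.
  intros Hp Hl. pose proof Hl as Hl'. unfold inD in Hl'.
  assert (Hi : 0 < / (1 - Cmod lam)) by (apply Rinv_0_lt_compat; lra).
  apply (in_Hp_intro p (kernel lam) (/ (1 - Cmod lam)) Hp (holo_kernel _ Hl)); [lra|].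
  intros r Hr. rewrite Mp_avg. apply avg_le_const.
  - apply cont_Mp; [lra | now apply holo_kernel | assumption].
  - intros t. apply rpow_le; [lra|]. split; [apply Cmod_ge_0|].
    assert (Hz : Cmod (circ r t) <= 1) by (rewrite Cmod_circ; lra).
    unfold kernel. rewrite Cmod_inv by now apply kernel_den_neq_0.
    apply Rinv_le_contravar; [lra | now apply kernel_den_ge].
Qed.

(** Multiplying the denominator by the unimodular number [circ 1 th] turns it into a difference of
    two points, so estimates of kernels become estimates of distances. *)
Lemma Cmod_kernel_circ s th z : inD (circ s th) -> Cmod z <= 1 ->
  Cmod (kernel (circ s th) z) = / Cmod (circ 1 th - RtoC s * z).
Proof.
  intros Hl Hz. unfold kernel. rewrite Cmod_inv by now apply kernel_den_neq_0.
  f_equal. transitivity (Cmod (1 - Cconj (circ s th) * z) * Cmod (circ 1 th)).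
  { rewrite (Cmod_circ 1) by lra. ring. }
  rewrite <- Cmod_mult. f_equal.
  assert (E : (Cconj (circ 1 th) * circ 1 th)%C = 1).
  { pose proof (sin2_cos2 th) as H. unfold Rsqr in H.
    apply injective_projections; simpl; lra. }
  replace (Cconj (circ s th)) with (RtoC s * Cconj (circ 1 th))%C
    by (apply injective_projections; simpl; ring).
  replace (RtoC s * z)%C with (RtoC s * z * (Cconj (circ 1 th) * circ 1 th))%C
    by (rewrite E; ring).
  ring.
Qed.

Lemma avg_ge_sub g a b c : cont g -> (forall t, 0 <= g t) -> 0 <= a <= b -> b <= 2 * PI ->
  (forall t, a <= t <= b -> c <= g t) -> (b - a) * c / (2 * PI) <= avg g.
Proof.
  intros Hg H0 Ha Hb Hc. pose proof two_PI_pos.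
  apply Rmult_le_compat_r; [left; now apply Rinv_0_lt_compat|].
  rewrite <- (RInt_Chasles g 0 a) by now apply cont_ex_RInt.
  rewrite <- (RInt_Chasles g a b) by now apply cont_ex_RInt.
  assert (0 <= RInt g 0 a) by (apply RInt_ge_0; auto using cont_ex_RInt; lra).
  assert (0 <= RInt g b (2 * PI)) by (apply RInt_ge_0; auto using cont_ex_RInt; lra).
  assert ((b - a) * c <= RInt g a b).
  { replace ((b - a) * c) with (RInt (fun _ => c) a b) by (rewrite RInt_const; reflexivity).
    apply RInt_le; auto using cont_ex_RInt, ex_RInt_const; [lra|].
    intros t Ht. apply Hc; lra. }
  unfold plus; simpl. lra.
Qed.

(** The number of nodes is [N = S n], because [sum_f_R0 _ n] has the terms [0..n]. The radius
    [rad n] lies at distance [1 / N] from the circle, comparable to the spacing of the nodes. *)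
Definition node (n j : nat) : R := 2 * PI * INR j / INR (S n).
Definition rad (n : nat) : R := 1 - / INR (S n).

Lemma INR_S_ge_1 n : 1 <= INR (S n).
Proof. rewrite S_INR. pose proof (pos_INR n). lra. Qed.

Lemma rad_bounds n : 0 <= rad n < 1.
Proof.
  unfold rad. pose proof (INR_S_ge_1 n).
  assert (0 < / INR (S n)) by (apply Rinv_0_lt_compat; lra).
  assert (/ INR (S n) <= / 1) by (apply Rinv_le_contravar; lra).
  rewrite Rinv_1 in *. lra.
Qed.

Lemma inD_node n j : inD (circ (rad n) (node n j)).
Proof. apply inD_circ, rad_bounds. Qed.

(** On the arc of length [1 / N] that starts at the node, on the circle of radius [rad n], the
    kernel is at least [N / 4]: the distance to the node is at most [2 / N] along the arc plus
    [1 - rad n * rad n <= 2 / N] radially. The remaining part of the mean is nonnegative. *)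
Lemma kernel_norm_ge p n j : 1 < p -> (j <= n)%nat ->
  rpow (/ 4) p / (2 * PI) * (rpow (INR (S n)) p / INR (S n))
    <= rpow (Hp_norm p (kernel (circ (rad n) (node n j)))) p.
Proof.
  intros Hp Hj. pose proof (INR_S_ge_1 n) as HN. pose proof (rad_bounds n) as Hr.
  pose proof two_PI_pos as Hpi. pose proof PI2_3_2 as Hpi2.
  pose proof (inD_node n j) as Hl. set (lam := circ (rad n) (node n j)) in *.
  eapply Rle_trans; [|apply (Mp_le_norm p _ (rad n) Hp); [now apply kernel_in_Hp | assumption]].
  rewrite Mp_avg. set (N := INR (S n)) in *.
  assert (HiN : 0 < / N) by (apply Rinv_0_lt_compat; lra).
  replace (rpow (/ 4) p / (2 * PI) * (rpow N p / N))
    with ((node n j + / N - node n j) * (rpow (/ 4 * N) p) / (2 * PI)).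
  2: { rewrite rpow_mult by lra. field. lra. }
  assert (Hnode : 0 <= node n j /\ node n j + / N <= 2 * PI).
  { unfold node. fold N. apply le_INR in Hj. pose proof (S_INR n) as E. fold N in E.
    pose proof (pos_INR j). split.
    - apply Rdiv_le_0_compat; [nra | lra].
    - replace (2 * PI * INR j / N + / N) with ((2 * PI * INR j + 1) / N) by (field; lra).
      apply Rle_div_l; [lra|]. nra. }
  apply avg_ge_sub; [| |lra|lra|].
  - apply cont_Mp; [lra | now apply holo_kernel | assumption].
  - intros t. apply rpow_ge_0.
  - intros t Ht. apply rpow_le; [lra|]. split; [nra|].
    assert (Hz : Cmod (circ (rad n) t) <= 1) by (rewrite Cmod_circ; lra).
    unfold lam. rewrite Cmod_kernel_circ by assumption.
    rewrite <- (Rinv_inv (/ 4 * N)). apply Rinv_le_contravar.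
    { pose proof (Cmod_le_sub (circ 1 (node n j)) (RtoC (rad n) * circ (rad n) t)) as H.
      rewrite Cmod_mult, Cmod_R, !Cmod_circ, Rabs_pos_eq in H by lra. nra. }
    replace (circ 1 (node n j) - RtoC (rad n) * circ (rad n) t)%C
      with ((circ 1 (node n j) - circ 1 t) + RtoC (1 - rad n * rad n) * circ 1 t)%C.
    2: { rewrite (circ_plus (rad n)), RtoC_minus, RtoC_mult. ring. }
    eapply Rle_trans; [apply Cmod_triangle|].
    rewrite Cmod_mult, Cmod_R, Cmod_circ, Rabs_pos_eq by nra.
    pose proof (Cmod_circ_sub 1 (node n j) t ltac:(lra)) as Hc.
    assert (Rabs (node n j - t) <= / N) by (apply Rabs_le; lra).
    replace (/ (/ 4 * N)) with (4 * / N) by (field; lra).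
    assert (1 - rad n * rad n <= 2 * / N).
    { unfold rad. fold N. nra. }
    lra.
Qed.

(** * Chord lengths and the sum of the kernels over the nodes *)

Lemma sin_ge_half y : 0 <= y <= PI / 2 -> y / 2 <= sin y.
Proof.
  assert (H : forall x, 0 <= x <= PI / 2 -> x * cos x <= sin x).
  { intros x Hx. destruct (MVT_gen sin 0 x cos) as [c [Hc E]].
    - intros t _. apply is_derive_Reals, derivable_pt_lim_sin.
    - intros t _. apply derivable_continuous_pt, derivable_pt_sin.
    - rewrite Rmin_left, Rmax_right in Hc by lra. rewrite sin_0 in E.
      assert (cos x <= cos c) by (apply cos_decr_1; lra). nra. }
  (* At the half angle: [sin y = 2 sin (y/2) cos (y/2) >= y cos^2 (y/2) = y (1 + cos y) / 2]. *)
  intros Hy. specialize (H (y / 2) ltac:(lra)).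
  assert (E1 : sin y = 2 * sin (y / 2) * cos (y / 2)).
  { rewrite <- sin_2a. f_equal; field. }
  assert (E2 : cos y = 2 * cos (y / 2) * cos (y / 2) - 1).
  { rewrite <- cos_2a_cos. f_equal; field. }
  assert (0 <= cos y) by (apply cos_ge_0; lra).
  assert (0 <= cos (y / 2)) by (apply cos_ge_0; lra).
  nra.
Qed.

Lemma chord_ge a b : Rabs (a - b) <= 2 * PI ->
  Rmin (Rabs (a - b)) (2 * PI - Rabs (a - b)) / 2 <= Cmod (circ 1 a - circ 1 b).
Proof.
  intros Hab. pose proof (Rabs_pos (a - b)) as Hx0. set (x := Rabs (a - b)) in *.
  assert (Hs : Rmin x (2 * PI - x) / 2 <= 2 * sin (x / 2) /\ 0 <= sin (x / 2)).
  { split; [|apply sin_ge_0; lra].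
    destruct (Rle_dec x PI).
    - rewrite Rmin_left by lra. pose proof (sin_ge_half (x / 2)). lra.
    - rewrite Rmin_right by lra. rewrite <- sin_PI_x.
      pose proof (sin_ge_half (PI - x / 2)). lra. }
  enough (Cmod (circ 1 a - circ 1 b) = 2 * sin (x / 2)) by lra.
  assert (E : Cmod (circ 1 a - circ 1 b) * Cmod (circ 1 a - circ 1 b)
      = (2 * sin (x / 2)) * (2 * sin (x / 2))).
  { rewrite Cmod_sqr. simpl.
    pose proof (sin2_cos2 a) as Ha. pose proof (sin2_cos2 b) as Hb. unfold Rsqr in *.
    assert (Hc : cos x = cos a * cos b + sin a * sin b).
    { rewrite <- cos_minus. unfold x, Rabs. destruct Rcase_abs; [apply cos_neg | reflexivity]. }
    pose proof (cos_2a_sin (x / 2)) as Hd. replace (2 * (x / 2)) with x in Hd by field. nra. }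
  pose proof (Cmod_ge_0 (circ 1 a - circ 1 b)). nra.
Qed.

(** The integral test with [G k = k^(1-p) / (p-1)], the integral of [x^(-p)] from [k] to infinity.
    The telescoping form is kept because the sum around the circle runs away from its centre in both
    directions. As [p - 1] may be less than 1, the key inequality is derived from [exp s >= 1 + s]
    and [ln (y / x) >= 1 / y]. *)
Lemma power_telescope p : 1 < p -> exists G : nat -> R,
  (forall k, 0 <= G k) /\ (forall k, rpow (/ INR (S k)) p <= G k - G (S k)).
Proof.
  intros Hp. set (v := fun k => rpow (/ INR k) (p - 1) / (p - 1)).
  assert (Hv : forall k, 0 <= v k).
  { intros k. apply Rdiv_le_0_compat; [apply rpow_ge_0 | lra]. }
  (* At 0 the formula would contain [/ 0]; the value is set so as to pay exactly for the first term,
     which is 1. *)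
  exists (fun k => match k with O => 1 + v 1%nat | S _ => v k end). split.
  - intros [|k]; [specialize (Hv 1%nat); lra | apply Hv].
  - intros [|k].
    + simpl INR. rewrite Rinv_1, rpow_1. lra.
    + unfold v. set (x := INR (S k)). pose proof (INR_S_ge_1 k) as Hx. fold x in Hx.
      rewrite (S_INR (S k)). fold x. set (y := x + 1).
      assert (Hix : 0 < / x) by (apply Rinv_0_lt_compat; lra).
      assert (Hiy : 0 < / y) by (apply Rinv_0_lt_compat; unfold y; lra).
      assert (E : rpow (/ y) p = rpow (/ y) (p - 1) * / y).
      { rewrite <- (rpow_1_r (/ y)) at 3 by lra. rewrite <- rpow_plus by assumption.
        f_equal; ring. }
      assert (H : 1 + (p - 1) * / y <= rpow (y / x) (p - 1)).
      { assert (Hyx : 0 < y / x) by (apply Rdiv_lt_0_compat; unfold y; lra).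
        rewrite rpow_pos by assumption. unfold Rpower.
        pose proof (exp_ineq1_le ((p - 1) * ln (y / x))) as H1.
        assert (Hxy : 0 < x / y) by (apply Rdiv_lt_0_compat; unfold y; lra).
        pose proof (ln_le_linear (x / y) Hxy) as H2.
        replace (x / y) with (/ (y / x)) in H2 by (field; unfold y; lra).
        rewrite ln_Rinv in H2 by assumption.
        replace (/ (y / x) - 1) with (- / y) in H2 by (unfold y; field; lra).
        nra. }
      assert (Hpos : 0 < rpow (/ y) (p - 1)) by now apply rpow_gt_0.
      assert (E2 : rpow (/ x) (p - 1) = rpow (/ y) (p - 1) * rpow (y / x) (p - 1)).
      { rewrite <- rpow_mult; [f_equal; field; unfold y; lra | lra |].
        apply Rdiv_le_0_compat; unfold y; lra. }
      rewrite E, E2.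
      replace (rpow (/ y) (p - 1) * rpow (y / x) (p - 1) / (p - 1) - rpow (/ y) (p - 1) / (p - 1))
        with (rpow (/ y) (p - 1) * ((rpow (y / x) (p - 1) - 1) / (p - 1))) by (field; lra).
      apply Rmult_le_compat_l; [lra|]. apply Rle_div_r; lra.
Qed.

Lemma sum_telescope (u V : nat -> R) n :
  (forall j, (j <= n)%nat -> u j <= V (S j) - V j) -> sum_f_R0 u n <= V (S n) - V 0%nat.
Proof.
  induction n as [|n IH]; intros H; simpl; [apply H; lia|].
  specialize (IH (fun j Hj => H j ltac:(lia))). specialize (H (S n) (le_n _)). lra.
Qed.

(** With truncated subtraction this is [|j - j0|], the number of steps one way round; the other way
    takes [S n] minus it. Sums carry a term for each way instead of a minimum. *)
Definition circle_dist (j j0 : nat) : nat := (j - j0) + (j0 - j).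

(* The potential [V] below increases by at least the summand at every step, since one of its
   two pairs of terms telescopes to the left of [j0] and the other one to the right. *)
Lemma cyclic_sum_bound p : 1 < p -> exists c, 0 < c /\ forall n j0, (j0 <= n)%nat ->
  sum_f_R0 (fun j => rpow (/ INR (S (circle_dist j j0))) p
                   + rpow (/ INR (S (S n - circle_dist j j0))) p) n <= c.
Proof.
  intros Hp. destruct (power_telescope p Hp) as [G [HG HGw]].
  assert (Hdec : forall k, G (S k) <= G k).
  { intros k. specialize (HGw k). pose proof (rpow_ge_0 (/ INR (S k)) p). lra. }
  assert (Hmax : forall k, G k <= G 0%nat).
  { induction k; [lra | specialize (Hdec k); lra]. }
  exists (4 * G 0%nat + 1). split; [specialize (HG 0%nat); lra|].
  intros n j0 Hj0.
  set (V := fun j => (G (S j0 - j)%nat - G (j - j0)%nat)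
     + (G (S n + S j0 - j)%nat - G (S n - j0 + j)%nat)).
  eapply Rle_trans; [apply (sum_telescope _ V)|].
  2: { unfold V.
       pose proof (HG (S n - j0)%nat). pose proof (Hmax (S j0 - S n)%nat).
       pose proof (HG (S n - j0 + S n)%nat). pose proof (Hmax (S n + S j0 - S n)%nat).
       pose proof (HG (S j0 - 0)%nat). pose proof (Hmax (0 - j0)%nat).
       pose proof (HG (S n + S j0 - 0)%nat). pose proof (Hmax (S n - j0 + 0)%nat). lra. }
  intros j Hj. unfold V, circle_dist.
  replace (S n + S j0 - S j)%nat with (S n + j0 - j)%nat by lia.
  replace (S n + S j0 - j)%nat with (S (S n + j0 - j))%nat by lia.
  replace (S n - j0 + S j)%nat with (S (S n - j0 + j))%nat by lia.
  replace (S j0 - S j)%nat with (j0 - j)%nat by lia.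
  pose proof (Hdec (S n + j0 - j)%nat). pose proof (Hdec (S n - j0 + j)%nat).
  destruct (Nat.le_gt_cases j j0) as [Hle | Hlt].
  - replace (j - j0 + (j0 - j))%nat with (j0 - j)%nat by lia.
    replace (S n - (j0 - j))%nat with (S n - j0 + j)%nat by lia.
    replace (S j0 - j)%nat with (S (j0 - j))%nat by lia.
    replace (j - j0)%nat with 0%nat by lia.
    pose proof (HGw (j0 - j)%nat). pose proof (HGw (S n - j0 + j)%nat).
    pose proof (Hmax (S j - j0)%nat). lra.
  - replace (j - j0 + (j0 - j))%nat with (j - j0)%nat by lia.
    replace (S n - (j - j0))%nat with (S n + j0 - j)%nat by lia.
    replace (S j - j0)%nat with (S (j - j0))%nat by lia.
    replace (j0 - j)%nat with 0%nat by lia. replace (S j0 - j)%nat with 0%nat by lia.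
    pose proof (HGw (j - j0)%nat). pose proof (HGw (S n + j0 - j)%nat). lra.
Qed.

Lemma node_sub_ge n j z : Cmod z <= 1 ->
  / INR (S n) <= Cmod (circ 1 (node n j) - RtoC (rad n) * z).
Proof.
  intros Hz. pose proof (rad_bounds n).
  pose proof (Cmod_le_sub (circ 1 (node n j)) (RtoC (rad n) * z)) as H1.
  rewrite Cmod_mult, Cmod_R, Cmod_circ, Rabs_pos_eq in H1 by lra.
  pose proof (Cmod_ge_0 z). assert (rad n * Cmod z <= rad n) by nra.
  unfold rad in *. lra.
Qed.

(** Let [j0] be the last node not beyond the argument of [z]. A kernel whose node is [m] steps from
    [j0], by the shorter way round, is at most [3 N / (m + 1)] at [z], and these powers are summed
    by [cyclic_sum_bound]. *)
Lemma kernel_sum_bound p : 1 < p -> exists c, 0 < c /\ forall n z, Cmod z <= 1 ->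
  sum_f_R0 (fun j => rpow (Cmod (kernel (circ (rad n) (node n j)) z)) p) n
    <= c * rpow (INR (S n)) p.
Proof.
  intros Hp. destruct (cyclic_sum_bound p Hp) as [c [Hc Hsum]].
  assert (H3 : 0 < rpow 3 p) by (apply rpow_gt_0; lra).
  exists (rpow 3 p * c). split; [nra|]. intros n z Hz.
  pose proof (INR_S_ge_1 n) as HN. pose proof two_PI_pos as Hpi. pose proof PI2_3_2 as Hpi2.
  pose proof (rad_bounds n) as Hr.
  destruct (polar_form z) as [phi [Hphi Ez]].
  destruct (nfloor_ex (phi * INR (S n) / (2 * PI))) as [j0 [Hj1 Hj2]].
  { apply Rdiv_le_0_compat; [nra | lra]. }
  apply Rle_div_r in Hj1; [|lra]. apply Rlt_div_l in Hj2; [|lra].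
  assert (Hj0 : (j0 <= n)%nat).
  { enough (j0 < S n)%nat by lia. apply INR_lt.
    apply (Rmult_lt_reg_r (2 * PI)); [lra|]. nra. }
  specialize (Hsum n j0 Hj0).
  assert (Hfac : 0 <= rpow (3 * INR (S n)) p) by apply rpow_ge_0.
  eapply Rle_trans; [|apply Rmult_le_compat_r with (r := rpow (INR (S n)) p);
    [apply rpow_ge_0 | apply Rmult_le_compat_l; [lra | exact Hsum]]].
  rewrite Rmult_comm, <- Rmult_assoc, <- rpow_mult, <- sum_f_R0_scal by lra.
  apply sum_Rle. intros j Hj. set (N := INR (S n)) in *. rewrite (Rmult_comm N 3).
  rewrite Cmod_kernel_circ by (assumption || apply inD_node).
  set (D := Cmod (circ 1 (node n j) - RtoC (rad n) * z)).
  assert (HD1 : / N <= D) by now apply node_sub_ge.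
  assert (HiN : 0 < / N) by (apply Rinv_0_lt_compat; lra).
  assert (HND : 1 <= N * D).
  { rewrite <- (Rinv_r N) by lra. apply Rmult_le_compat_l; lra. }
  set (x := Rabs (node n j - phi)).
  set (dd := circle_dist j j0).
  assert (Hdd : (dd <= n)%nat) by (unfold dd, circle_dist; lia).
  assert (Eddl : INR dd = Rabs (INR j - INR j0)).
  { unfold dd, circle_dist. destruct (Nat.le_gt_cases j j0).
    - rewrite Rabs_left1 by (apply le_INR in H; lra).
      replace (j - j0 + (j0 - j))%nat with (j0 - j)%nat by lia. rewrite minus_INR by lia. ring.
    - rewrite Rabs_pos_eq by (apply Nat.lt_le_incl, le_INR in H; lra).
      replace (j - j0 + (j0 - j))%nat with (j - j0)%nat by lia. rewrite minus_INR by lia. ring. }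
  assert (Enode : N * (node n j - phi) = 2 * PI * INR j - phi * N).
  { unfold node. fold N. field. lra. }
  (* The argument [phi] lies within one spacing [2 * PI / N] of the node [j0], hence the error of
     one step either way. *)
  assert (HNx : 2 * PI * (INR dd - 1) <= N * x /\ N * x <= 2 * PI * (INR dd + 1)).
  { unfold x. rewrite <- (Rabs_pos_eq N) by lra. rewrite <- Rabs_mult, Enode, Eddl.
    unfold Rabs; repeat destruct Rcase_abs; nra. }
  assert (Hx2 : x <= 2 * PI).
  { unfold x. apply le_INR in Hj. pose proof (S_INR n) as EN. fold N in EN.
    assert (0 <= node n j).
    { unfold node. fold N. apply Rdiv_le_0_compat; [pose proof (pos_INR j); nra | lra]. }
    assert (node n j <= 2 * PI).
    { unfold node. fold N. apply Rle_div_l; [lra|]. nra. }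
    apply Rabs_le; lra. }
  (* Projecting [rad n * z] radially to the circle moves it by [1 - q <= D], so the chord is at most
     [2 * D]; [chord_ge] supplies the other factor 2. *)
  assert (HD2 : Rmin x (2 * PI - x) / 4 <= D).
  { pose proof (chord_ge (node n j) phi Hx2) as Hch. fold x in Hch.
    set (q := rad n * Cmod z).
    assert (Hq : 0 <= q <= 1) by (unfold q; pose proof (Cmod_ge_0 z); nra).
    assert (Eq : (RtoC (rad n) * z)%C = circ q phi).
    { rewrite Ez at 1. rewrite (circ_plus (Cmod z)), (circ_plus q). unfold q.
      rewrite RtoC_mult. ring. }
    assert (H1 : 1 - q <= D).
    { pose proof (Cmod_le_sub (circ 1 (node n j)) (RtoC (rad n) * z)) as H1.
      fold D in H1. rewrite Eq, !Cmod_circ in H1 by lra. lra. }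
    assert (H2 : Cmod (circ 1 (node n j) - circ 1 phi) <= D + (1 - q)).
    { replace (circ 1 (node n j) - circ 1 phi)%C
        with ((circ 1 (node n j) - RtoC (rad n) * z) + - (RtoC (1 - q) * circ 1 phi))%C.
      - eapply Rle_trans; [apply Cmod_triangle|]. fold D.
        rewrite Cmod_opp, Cmod_mult, Cmod_R, Cmod_circ, Rabs_pos_eq by lra. lra.
      - rewrite Eq, (circ_plus q), RtoC_minus. ring. }
    lra. }
  (* Together with [1 <= N * D] the premise gives [m + 1 <= 3 * (N * D)], the origin of the factor
     3. *)
  assert (Hinv : forall m : nat, INR m - 1 <= N * D ->
     rpow (/ D) p <= rpow (3 * N) p * rpow (/ INR (S m)) p).
  { intros m Hm. pose proof (INR_S_ge_1 m) as HSm. rewrite <- rpow_mult.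
    - assert (HD0 : 0 < D) by lra.
      apply rpow_le; [lra|]. split; [left; now apply Rinv_0_lt_compat|].
      rewrite S_INR in *.
      apply (Rmult_le_reg_l D); [assumption|]. rewrite Rinv_r by lra.
      replace (D * (3 * N * / (INR m + 1))) with (3 * (N * D) / (INR m + 1)) by (field; lra).
      apply Rle_div_r; lra.
    - lra.
    - left. apply Rinv_0_lt_compat. lra. }
  fold dd. rewrite Rmult_plus_distr_l.
  assert (Hpos : forall m, 0 <= rpow (3 * N) p * rpow (/ INR (S m)) p).
  { intros m. apply Rmult_le_pos; apply rpow_ge_0. }
  destruct (Rle_dec x (2 * PI - x)) as [Hle | Hgt].
  - rewrite Rmin_left in HD2 by assumption.
    pose proof (Hpos (S n - dd)%nat). pose proof (Hinv dd) as Hi. 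
    assert (INR dd - 1 <= N * D); [|specialize (Hi H0); lra].
    assert (N * (x / 4) <= N * D) by (apply Rmult_le_compat_l; lra).
    destruct (Rle_dec (INR dd) 1); [lra|].
    assert (6 * (INR dd - 1) <= 2 * PI * (INR dd - 1)) by (apply Rmult_le_compat_r; lra). lra.
  - rewrite Rmin_right in HD2 by lra.
    pose proof (Hpos dd). pose proof (Hinv (S n - dd)%nat) as Hi.
    assert (INR (S n - dd) - 1 <= N * D); [|specialize (Hi H0); lra].
    rewrite minus_INR by lia. fold N.
    assert (N * ((2 * PI - x) / 4) <= N * D) by (apply Rmult_le_compat_l; lra).
    destruct (Rle_dec (N - INR dd) 1); [lra|].
    assert (6 * (N - INR dd - 1) <= 2 * PI * (N - INR dd - 1)) by (apply Rmult_le_compat_r; lra).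
    lra.
Qed.

(** * The reverse Carleson estimate *)

Lemma holo_Wcomp h psi f : holo_D h -> holo_D psi -> (forall z, inD z -> inD (psi z)) ->
  holo_D f -> holo_D (Wcomp h psi f).
Proof.
  intros Hh Hpsi HD Hf. apply (holo_mult h (fun z => f (psi z))); [assumption|].
  rewrite holo_cdiff in *. intros z Hz. apply cdiff_comp; auto.
Qed.

(** A lower bound on a norm yields a radius that depends on the function. The means increase with
    the radius, so the largest of finitely many radii serves all functions at once. *)
Lemma common_radius p (F : nat -> C -> C) a n : 1 < p -> (forall j, holo_D (F j)) ->
  (forall j, (j <= n)%nat -> exists r, 0 <= r < 1 /\ a < Mp p (F j) r) ->
  exists r, 0 <= r < 1 /\ forall j, (j <= n)%nat -> a <= Mp p (F j) r.
Proof.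
  intros Hp HF. induction n as [|n IH]; intros H.
  - destruct (H 0%nat (le_n _)) as [r [Hr Hlt]]. exists r. split; [assumption|].
    intros j Hj. replace j with 0%nat by lia. lra.
  - destruct IH as [r [Hr Hle]]; [intros j Hj; apply H; lia|].
    destruct (H (S n) (le_n _)) as [r' [Hr' Hlt]].
    assert (Hm : 0 <= Rmax r r' < 1).
    { split; [pose proof (Rmax_l r r'); lra | apply Rmax_lub_lt; lra]. }
    exists (Rmax r r'). split; [assumption|]. intros j Hj.
    destruct (Nat.eq_dec j (S n)) as [-> | Hn].
    + apply Rle_trans with (Mp p (F (S n)) r'); [lra|].
      apply Mp_monotone; auto; [split; [lra | apply Rmax_r] | lra].
    + apply Rle_trans with (Mp p (F j) r); [apply Hle; lia|].
      apply Mp_monotone; auto; [split; [lra | apply Rmax_l] | lra].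
Qed.

Lemma rpow_inv_small a c eps : 0 < a -> 0 <= c -> 0 < eps ->
  exists N0, forall N, N0 <= N -> 0 < N -> c * rpow (/ N) a <= eps.
Proof.
  intros Ha Hc He. set (t := eps / (c + 1)).
  assert (Ht : 0 < t) by (apply Rdiv_lt_0_compat; lra).
  assert (Hs : 0 < rpow t (1 / a)) by now apply rpow_gt_0.
  exists (/ rpow t (1 / a)). intros N HN HN0.
  assert (HiN : 0 < / N) by now apply Rinv_0_lt_compat.
  assert (Hle : / N <= rpow t (1 / a)).
  { rewrite <- (Rinv_inv (rpow t (1 / a))).
    apply Rinv_le_contravar; [now apply Rinv_0_lt_compat | assumption]. }
  pose proof (rpow_le (/ N) _ a Ha (conj (Rlt_le _ _ HiN) Hle)) as H.
  rewrite root_rpow in H by lra. pose proof (rpow_ge_0 (/ N) a).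
  apply Rle_trans with (c * t); [nra|].
  unfold t. replace (c * (eps / (c + 1))) with (eps * (c / (c + 1))) by (field; lra).
  assert (c / (c + 1) <= 1) by (apply Rle_div_l; lra). nra.
Qed.

(* Off the [d]-neighbourhood of the node the kernel is bounded by [2 / d]; inside it
   [u] varies by at most [e]. *)
Lemma kernel_average_le p c n u B d e z : 1 < p ->
  (forall w, Cmod w <= 1 -> sum_f_R0 (fun j => rpow (Cmod (kernel (circ (rad n) (node n j)) w)) p) n
    <= c * rpow (INR (S n)) p) ->
  0 < d -> 0 <= e -> / INR (S n) <= d / 2 ->
  (forall w, cdisc 1 w -> 0 <= u w <= B) ->
  (forall w w', cdisc 1 w -> cdisc 1 w' -> Cmod (w' - w) < d -> Rabs (u w' - u w) < e) ->
  Cmod z <= 1 ->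
  sum_f_R0 (fun j => u (circ 1 (node n j)) * rpow (Cmod (kernel (circ (rad n) (node n j)) z)) p) n
    <= (u z + e) * (c * rpow (INR (S n)) p) + INR (S n) * (B * rpow (2 / d) p).
Proof.
  intros Hp Hsum Hd He Hn Hu Hunif Hz. pose proof (INR_S_ge_1 n) as HN.
  assert (HB : 0 <= B) by (pose proof (Hu z Hz); lra).
  pose proof (rpow_ge_0 (2 / d) p) as H2d.
  pose proof (Hu z Hz) as Huz.
  eapply Rle_trans; [|apply Rplus_le_compat_r, Rmult_le_compat_l, (Hsum z Hz); lra].
  rewrite (Rmult_comm (INR (S n))), <- (sum_cte (B * rpow (2 / d) p) n).
  rewrite <- sum_f_R0_scal, <- plus_sum.
  apply sum_Rle. intros j Hj. set (k := rpow (Cmod (kernel _ z)) p).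
  assert (Hk : 0 <= k) by apply rpow_ge_0.
  assert (Hc : cdisc 1 (circ 1 (node n j))) by (unfold cdisc; rewrite Cmod_circ; lra).
  pose proof (Hu _ Hc) as Huj.
  destruct (Rlt_dec (Cmod (circ 1 (node n j) - z)) d) as [Hlt | Hge].
  - specialize (Hunif z _ Hz Hc Hlt). apply Rabs_def2 in Hunif.
    apply Rle_trans with ((u z + e) * k); [apply Rmult_le_compat_r; lra|].
    assert (0 <= B * rpow (2 / d) p) by now apply Rmult_le_pos. lra.
  - assert (Hk2 : k <= rpow (2 / d) p).
    { apply rpow_le; [lra|]. split; [apply Cmod_ge_0|].
      rewrite Cmod_kernel_circ by (assumption || apply inD_node).
      replace (2 / d) with (/ (d / 2)) by (field; lra).
      apply Rinv_le_contravar; [lra|].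
      pose proof (Cmod_le_sub (circ 1 (node n j) - z) (circ 1 (node n j) - RtoC (rad n) * z)) as H.
      replace (circ 1 (node n j) - z - (circ 1 (node n j) - RtoC (rad n) * z))%C
        with (- (RtoC (1 - rad n) * z))%C in H by (rewrite RtoC_minus; ring).
      pose proof (rad_bounds n). rewrite Cmod_opp, Cmod_mult, Cmod_R, Rabs_pos_eq in H by lra.
      assert ((1 - rad n) * Cmod z <= / INR (S n)).
      { unfold rad in *. pose proof (Cmod_ge_0 z). nra. }
      lra. }
    apply Rle_trans with (B * rpow (2 / d) p); [apply Rmult_le_compat; lra|].
    assert (0 <= (u z + e) * k) by (apply Rmult_le_pos; lra). lra.
Qed.

Section ReverseCarleson.

Variables (p Cst : R) (h psi : C -> C).
Hypothesis (Hp : 1 < p) (Hh : in_Hp p h) (Hpsi : holo_D psi).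
Hypothesis HD : forall z, inD z -> inD (psi z).
Hypothesis HW : forall f, in_Hp p f -> in_Hp p (Wcomp h psi f).
Hypothesis HC : 0 < Cst.
Hypothesis Hker : forall lam, inD lam ->
  Hp_norm p (Wcomp h psi (kernel lam)) >= Cst * Hp_norm p (kernel lam).

(** Halving [Cst] produces the strict inequality from which [Mp_lt_norm] extracts a radius; the
    second factor is that of [kernel_norm_ge]. *)
Let kappa := rpow (Cst / 2) p * (rpow (/ 4) p / (2 * PI)).

Let kappa_pos : 0 < kappa.
Proof.
  pose proof two_PI_pos. apply Rmult_lt_0_compat; [apply rpow_gt_0; lra|].
  apply Rdiv_lt_0_compat; [apply rpow_gt_0; lra | assumption].
Qed.

Let kernel_means n : exists r, 0 <= r < 1 /\ forall j, (j <= n)%nat ->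
  kappa * (rpow (INR (S n)) p / INR (S n))
    <= Mp p (Wcomp h psi (kernel (circ (rad n) (node n j)))) r.
Proof.
  apply (common_radius p (fun j => Wcomp h psi (kernel (circ (rad n) (node n j))))); [assumption| |].
  - intros j. apply holo_Wcomp; auto; [apply Hh | apply holo_kernel, inD_node].
  - intros j Hj. set (lam := circ (rad n) (node n j)).
    assert (Hl : inD lam) by apply inD_node.
    pose proof (kernel_in_Hp p lam Hp Hl) as Hk.
    pose proof (kernel_norm_ge p n j Hp Hj) as Hn. fold lam in Hn.
    pose proof (INR_S_ge_1 n) as HN.
    assert (Hpos : 0 < rpow (INR (S n)) p / INR (S n)).
    { apply Rdiv_lt_0_compat; [apply rpow_gt_0; lra | lra]. }
    pose proof two_PI_pos as Hpi.
    assert (H4 : 0 < rpow (/ 4) p / (2 * PI)).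
    { apply Rdiv_lt_0_compat; [apply rpow_gt_0; lra | assumption]. }
    assert (Hnk : 0 < Hp_norm p (kernel lam)).
    { destruct (Hp_norm_ge_0 p _ Hp Hk) as [H | E]; [assumption|].
      rewrite <- E, rpow_0 in Hn. assert (0 < rpow (/ 4) p / (2 * PI) * (rpow (INR (S n)) p / INR (S n)))
        by now apply Rmult_lt_0_compat. lra. }
    destruct (Mp_lt_norm p (Wcomp h psi (kernel lam)) (Cst / 2 * Hp_norm p (kernel lam)))
      as [r [Hr Hlt]]; [assumption | auto | |].
    { specialize (Hker lam Hl). nra. }
    exists r. split; [assumption|]. eapply Rle_lt_trans; [|exact Hlt].
    rewrite rpow_mult by lra. unfold kappa. rewrite Rmult_assoc.
    apply Rmult_le_compat_l; [apply rpow_ge_0 | exact Hn].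
Qed.

(** For [rho < 1] the function [u = |dil rho f|^p] is continuous on the closed disc, and its mean
    over the unit circle is [Mp p f rho]. Comparing a lower and an upper bound of the same sum over
    the nodes gives the claim with [A = c / kappa], independent of [f] and [rho]. *)
Lemma dil_mean_le : exists A, 0 < A /\ forall f rho B, holo_D f -> 0 <= rho < 1 ->
  (forall r, 0 <= r < 1 -> Mp p (Wcomp h psi (dil rho f)) r <= B) ->
  Mp p f rho <= A * B.
Proof.
  destruct (kernel_sum_bound p Hp) as [c [Hc Hsum]].
  exists (c / kappa). split; [now apply Rdiv_lt_0_compat|].
  intros f rho B Hf Hrho HB.
  set (Hn := rpow (Hp_norm p h) p).
  assert (HHn : 0 <= Hn) by apply rpow_ge_0.
  assert (Hg : holo_D (dil rho f)) by (apply holo_dil; lra || assumption).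
  set (u := fun z => rpow (Cmod (dil rho f z)) p).
  assert (Hu : forall z, cdisc 1 z -> rcont (cdisc 1) u z).
  { intros z Hz. unfold u, dil.
    assert (HzD : forall w, cdisc 1 w -> inD (RtoC rho * w)%C).
    { unfold cdisc, inD. intros w Hw. rewrite Cmod_mult, Cmod_R, Rabs_pos_eq by lra.
      pose proof (Cmod_ge_0 w). nra. }
    apply (rcont_comp _ inD (fun w => rpow (Cmod (f w)) p) (fun w => RtoC rho * w)%C).
    - exact HzD.
    - apply ccont_mult; [apply ccont_const | apply ccont_id].
    - apply rcont_Cmod_rpow; [lra|]. apply holo_ccont; auto. }
  destruct (cdisc_bounded 1 u ltac:(lra) Hu) as [Bu HBu].
  assert (HBu' : forall w, cdisc 1 w -> 0 <= u w <= Bu).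
  { intros w Hw. specialize (HBu w Hw). assert (0 <= u w) by apply rpow_ge_0.
    rewrite Rabs_pos_eq in HBu; lra. }
  assert (HBu0 : 0 <= Bu).
  { destruct (HBu' 0%C); [unfold cdisc; rewrite Cmod_0; lra | lra]. }
  replace (c / kappa * B) with (c * B / kappa) by (field; lra).
  apply (Rle_div_r (Mp p f rho) (c * B) kappa kappa_pos). rewrite Rmult_comm.
  apply Rle_plus_epsilon. intros eps He.
  (* The oscillation [e] of [u] is paid twice: times [c * Hn] in the kernel average and times
     [kappa] in the Riemann sum, [eps / 2] in all. *)
  set (e := eps / (2 * (c * Hn + kappa))).
  assert (HcHn : 0 <= c * Hn) by (apply Rmult_le_pos; lra).
  assert (He0 : 0 < e) by (apply Rdiv_lt_0_compat; lra).
  destruct (cdisc_uniform_R 1 u Hu e He0) as [d [Hd Hunif]].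
  (* The nodes at distance at least [d] contribute at most [Q * N^(1-p)] after division by [N^p]. *)
  set (Q := Bu * rpow (2 / d) p * Hn).
  assert (HQ : 0 <= Q).
  { apply Rmult_le_pos; [|assumption]. apply Rmult_le_pos; [assumption | apply rpow_ge_0]. }
  destruct (rpow_inv_small (p - 1) Q (eps / 2) ltac:(lra) HQ ltac:(lra)) as [N0 HN0].
  pose proof two_PI_pos as Hpi. pose proof PI2_3_2 as Hpi2.
  assert (H4d : 0 < 4 * (2 * PI) / d) by (apply Rdiv_lt_0_compat; lra).
  (* The first bound makes the far nodes negligible; the second gives both [/ N <= d / 2] for the
     kernels and a spacing under which [u] varies by less than [e]. *)
  destruct (nfloor_ex (Rmax N0 (4 * (2 * PI) / d))) as [n [_ HnN]].
  { pose proof (Rmax_r N0 (4 * (2 * PI) / d)). lra. }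
  rewrite <- S_INR in HnN. pose proof (INR_S_ge_1 n) as HN.
  set (N := INR (S n)) in *.
  assert (HNN0 : N0 <= N) by (pose proof (Rmax_l N0 (4 * (2 * PI) / d)); lra).
  assert (HNd : 4 * (2 * PI) / d <= N) by (pose proof (Rmax_r N0 (4 * (2 * PI) / d)); lra).
  apply Rle_div_l in HNd; [|assumption].
  specialize (HN0 N HNN0 ltac:(lra)).
  destruct (kernel_means n) as [r [Hr Hmeans]]. fold N in Hmeans.
  set (g := fun j => u (circ 1 (node n j))).
  assert (Hnode : forall j, cdisc 1 (circ 1 (node n j))).
  { intros j. unfold cdisc. rewrite Cmod_circ; lra. }
  assert (Hg0 : forall j, 0 <= g j) by (intros j; apply HBu', Hnode).
  assert (HkW : forall j, holo_D (Wcomp h psi (kernel (circ (rad n) (node n j))))).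
  { intros j. apply holo_Wcomp; auto; [apply Hh | apply holo_kernel, inD_node]. }
  assert (HfW : holo_D (Wcomp h psi (dil rho f))) by (apply holo_Wcomp; auto; apply Hh).
  set (Np := rpow N p).
  assert (HNp : 0 < Np) by (apply rpow_gt_0; lra).
  (* [kernel_average_le] at the point [psi z], multiplied by [|h z|^p] and averaged over the circle
     of radius [r]. The error terms are constants times [|h|^p], so only the mean of [|h|^p] is
     needed for them. *)
  assert (Hupper : sum_f_R0 (fun j => g j * Mp p (Wcomp h psi (kernel (circ (rad n) (node n j)))) r) n
     <= c * Np * Mp p (Wcomp h psi (dil rho f)) r
        + (e * (c * Np) + N * (Bu * rpow (2 / d) p)) * Mp p h r).
  { assert (Ck : forall j, cont (fun t => rpow (Cmod (Wcomp h psi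
        (kernel (circ (rad n) (node n j))) (circ r t))) p)) by (intros j; apply cont_Mp; auto; lra).
    assert (CW : cont (fun t => rpow (Cmod (Wcomp h psi (dil rho f) (circ r t))) p))
      by (apply cont_Mp; auto; lra).
    assert (Ch : cont (fun t => rpow (Cmod (h (circ r t))) p))
      by (apply cont_Mp; [lra | apply Hh | assumption]).
    rewrite (sum_eq _ (fun j => avg (fun t => g j * rpow (Cmod (Wcomp h psi
        (kernel (circ (rad n) (node n j))) (circ r t))) p))).
    2: { intros j _. now rewrite avg_scal. }
    rewrite <- avg_sum by (intros j; now apply cont_scal).
    rewrite !Mp_avg, <- !avg_scal, <- avg_plus by
      repeat (assumption || apply cont_plus || apply cont_scal).
    apply avg_le.
    - apply (cont_sum (fun j t => g j * rpow (Cmod (Wcomp h psi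
        (kernel (circ (rad n) (node n j))) (circ r t))) p)). intros j. now apply cont_scal.
    - repeat (assumption || apply cont_plus || apply cont_scal).
    - intros t. set (z := circ r t).
      assert (Hz : inD z) by now apply inD_circ.
      specialize (HD z Hz). unfold inD in HD. unfold Wcomp.
      set (H0 := rpow (Cmod (h z)) p). assert (HH0 : 0 <= H0) by apply rpow_ge_0.
      rewrite (sum_eq _ (fun j => H0 * (u (circ 1 (node n j)) *
        rpow (Cmod (kernel (circ (rad n) (node n j)) (psi z))) p))).
      2: { intros j _. rewrite Cmod_mult, rpow_mult by apply Cmod_ge_0. fold H0. unfold g. ring. }
      rewrite sum_f_R0_scal, Cmod_mult, rpow_mult by apply Cmod_ge_0. fold H0 (u (psi z)).
      assert (HNd2 : / INR (S n) <= d / 2).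
      { apply (Rmult_le_reg_l N); [lra|]. unfold N at 1. rewrite Rinv_r by (fold N; lra). nra. }
      pose proof (kernel_average_le p c n u Bu d e (psi z) Hp (Hsum n) Hd (Rlt_le _ _ He0)
        HNd2 HBu' Hunif (Rlt_le _ _ HD)) as Hav.
      fold N Np in Hav.
      apply (Rmult_le_compat_l H0) in Hav; [|assumption].
      eapply Rle_trans; [exact Hav|]. right; ring. }
  assert (Hlower : kappa * (Np / N) * sum_f_R0 g n
     <= sum_f_R0 (fun j => g j * Mp p (Wcomp h psi (kernel (circ (rad n) (node n j)))) r) n).
  { rewrite <- sum_f_R0_scal. apply sum_Rle. intros j Hj. specialize (Hmeans j Hj).
    rewrite Rmult_comm. apply Rmult_le_compat_l; [apply Hg0 | exact Hmeans]. }
  assert (Hriem : Mp p f rho - e <= sum_f_R0 g n / N).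
  { assert (E : Mp p f rho = avg (fun t => u (circ 1 t))).
    { rewrite Mp_avg. apply avg_ext. intros t. unfold u, dil. now rewrite <- circ_plus. }
    pose proof (riemann_sum_avg (fun t => u (circ 1 t)) n e) as R.
    rewrite E. fold N in R.
    enough (R' : Rabs (avg (fun t => u (circ 1 t)) - sum_f_R0 g n / N) <= e).
    { apply Rabs_le_between in R'. lra. }
    apply R.
    - apply (cont_circ (cdisc 1)); auto; [lra|]. intros t. unfold cdisc. rewrite Cmod_circ; lra.
    - intros s t Hst. left. apply Hunif; [unfold cdisc; rewrite Cmod_circ; lra..|].
      eapply Rle_lt_trans; [apply Cmod_circ_sub; lra|].
      apply Rle_div_r in Hst; [|lra]. pose proof (Rabs_pos (t - s)).
      apply (Rmult_lt_reg_r N); [lra|]. lra. }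
  specialize (HB r Hr).
  assert (HMh : Mp p h r <= Hn) by now apply Mp_le_norm.
  assert (HNN : N * rpow (/ N) p = rpow (/ N) (p - 1)).
  { assert (0 < / N) by (apply Rinv_0_lt_compat; lra).
    replace p with (1 + (p - 1)) at 1 by ring.
    rewrite rpow_plus, rpow_1_r by lra. field. lra. }
  assert (HNpi : rpow (/ N) p = / Np) by (apply rpow_inv; lra).
  assert (Hdiv : kappa * (sum_f_R0 g n / N)
     <= c * B + (e * c + N * (Bu * rpow (2 / d) p) / Np) * Hn).
  { apply (Rmult_le_reg_l Np); [assumption|].
    replace (Np * (kappa * (sum_f_R0 g n / N))) with (kappa * (Np / N) * sum_f_R0 g n)
      by (field; lra).
    replace (Np * (c * B + (e * c + N * (Bu * rpow (2 / d) p) / Np) * Hn))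
      with (c * Np * B + (e * (c * Np) + N * (Bu * rpow (2 / d) p)) * Hn) by (field; lra).
    eapply Rle_trans; [exact Hlower|]. eapply Rle_trans; [exact Hupper|].
    assert (0 <= c * Np) by nra.
    assert (0 <= Bu * rpow (2 / d) p) by (apply Rmult_le_pos; [assumption | apply rpow_ge_0]).
    apply Rplus_le_compat; apply Rmult_le_compat_l; try assumption.
    apply Rplus_le_le_0_compat; apply Rmult_le_pos; lra. }
  assert (Etail : N * (Bu * rpow (2 / d) p) / Np * Hn = Q * rpow (/ N) (p - 1)).
  { rewrite <- HNN, HNpi. unfold Q. field. lra. }
  assert (He1 : e * (c * Hn + kappa) = eps / 2) by (unfold e; field; lra).
  assert (kappa * (Mp p f rho - e) <= kappa * (sum_f_R0 g n / N))
    by (apply Rmult_le_compat_l; lra).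
  nra.
Qed.

End ReverseCarleson.

(** * From dilations to arbitrary functions in the Hardy space *)

Lemma rpow_Cmod_add_le p (a b : C) : 0 < p ->
  rpow (Cmod (a + b)) p <= rpow 2 p * (rpow (Cmod a) p + rpow (Cmod b) p).
Proof.
  intros Hp. pose proof (Cmod_triangle a b). pose proof (Cmod_ge_0 a). pose proof (Cmod_ge_0 b).
  pose proof (Cmod_ge_0 (a + b)).
  pose proof (rpow_ge_0 2 p). pose proof (rpow_ge_0 (Cmod a) p). pose proof (rpow_ge_0 (Cmod b) p).
  destruct (Rle_dec (Cmod a) (Cmod b)).
  - apply Rle_trans with (rpow 2 p * rpow (Cmod b) p); [|nra].
    rewrite <- rpow_mult by lra. apply rpow_le; lra.
  - apply Rle_trans with (rpow 2 p * rpow (Cmod a) p); [|nra].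
    rewrite <- rpow_mult by lra. apply rpow_le; lra.
Qed.

Theorem theorem2p2 (p : R) (h psi : C -> C) :
  1 < p ->
  in_Hp p h ->
  holo_D psi ->
  (forall z, inD z -> inD (psi z)) ->
  Wbounded p h psi ->
  ((exists delta : R, 0 < delta /\
      forall f, in_Hp p f ->
        Hp_norm p (Wcomp h psi f) >= delta * Hp_norm p f)
   <->
   (exists Cst : R, 0 < Cst /\
      forall lam : C, inD lam ->
        Hp_norm p (Wcomp h psi (kernel lam)) >= Cst * Hp_norm p (kernel lam))).
Proof.
  intros Hp Hh Hpsi HD [HW [M HM]]. split.
  - intros [delta [Hdelta H]]. exists delta. split; [assumption|].
    intros lam Hl. now apply H, kernel_in_Hp.
  - intros [Cst [HC Hker]].
    destruct (dil_mean_le p Cst h psi Hp Hh Hpsi HD HW HC Hker) as [A [HA Hdil]].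
    assert (H2 : 0 < rpow 2 p) by (apply rpow_gt_0; lra).
    set (K := A * rpow 2 p). assert (HK : 0 < K) by (apply Rmult_lt_0_compat; lra).
    assert (HK' : 0 < rpow K (1 / p)) by now apply rpow_gt_0.
    exists (/ rpow K (1 / p)). split; [now apply Rinv_0_lt_compat|].
    intros f Hf. set (nW := Hp_norm p (Wcomp h psi f)).
    assert (HnW : 0 <= nW) by (apply Hp_norm_ge_0; auto).
    enough (Hfin : Hp_norm p f <= rpow K (1 / p) * nW).
    { apply Rle_ge. rewrite Rmult_comm. apply Rle_div_l; [assumption|]. lra. }
    apply in_Hp_intro; [assumption | apply Hf | apply Rmult_le_pos; lra |].
    intros r Hr. rewrite rpow_mult, root_rpow by lra.
    apply Rle_plus_epsilon. intros eps He.
    set (M' := Rmax 0 M). assert (HM0 : 0 <= M') by apply Rmax_l.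
    pose proof (rpow_ge_0 M' p) as HMp.
    (* Chosen so that the error [K * (rpow M' p * e)] of replacing [f] by its dilation is at most
       [eps]; the summand 1 guards against [M' = 0]. *)
    set (e := eps / (K * (rpow M' p + 1))).
    assert (He0 : 0 < e) by (apply Rdiv_lt_0_compat; nra).
    destruct (dil_converges_Hp p f e Hp Hf He0) as [rho1 [Hrho1 Hconv]].
    (* Besides being close enough to 1, [rho] must be at least [r], so that the mean at [r] is
       bounded by the mean at [rho]. *)
    set (rho := Rmax rho1 r).
    assert (Hrho : rho1 <= rho < 1 /\ r <= rho).
    { unfold rho. repeat split; [apply Rmax_l | apply Rmax_lub_lt; lra | apply Rmax_r]. }
    set (F := fun z => (f z - dil rho f z)%C).
    assert (Hg : holo_D (dil rho f)) by (apply holo_dil; [lra | apply Hf]).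
    destruct (in_Hp_intro p F (rpow e (1 / p)) Hp) as [HF HFn].
    { apply holo_minus; [apply Hf | assumption]. }
    { apply rpow_ge_0. }
    { intros s Hs. rewrite root_rpow by lra. apply Hconv; lra. }
    (* Here the norm bound on the operator enters: it transports the smallness of [f - dil rho f] to
       its image. *)
    assert (HWF : Hp_norm p (Wcomp h psi F) <= M' * rpow e (1 / p)).
    { eapply Rle_trans; [now apply HM|].
      pose proof (Hp_norm_ge_0 p F Hp HF). pose proof (Rmax_r 0 M). fold M' in H0. nra. }
    assert (HWFp : rpow (Hp_norm p (Wcomp h psi F)) p <= rpow M' p * e).
    { rewrite <- (root_rpow e p) by lra. rewrite <- rpow_mult by (lra || apply rpow_ge_0).
      apply rpow_le; [lra|]. split; [apply Hp_norm_ge_0; auto | exact HWF]. }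
    apply Rle_trans with (Mp p f rho).
    { apply Mp_monotone; [assumption | apply Hf | lra | lra]. }
    eapply Rle_trans.
    { apply (Hdil f rho (rpow 2 p * (rpow nW p + rpow M' p * e))); [apply Hf | lra |].
      intros s Hs.
      assert (C1 : cont (fun t => rpow (Cmod (Wcomp h psi f (circ s t))) p)).
      { apply cont_Mp; [lra | apply HW, Hf | assumption]. }
      assert (C2 : cont (fun t => rpow (Cmod (Wcomp h psi F (circ s t))) p)).
      { apply cont_Mp; [lra | now apply HW | assumption]. }
      apply Rle_trans with (rpow 2 p * (Mp p (Wcomp h psi f) s + Mp p (Wcomp h psi F) s)).
      - rewrite !Mp_avg, <- avg_plus, <- avg_scal by (repeat (assumption || apply cont_plus)).
        apply avg_le.
        + apply cont_Mp; [lra | apply holo_Wcomp; auto; apply Hh | assumption].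
        + repeat (assumption || apply cont_plus || apply cont_scal).
        + intros t. set (z := circ s t).
          rewrite <- (Cmod_opp (Wcomp h psi F z)).
          replace (Wcomp h psi (dil rho f) z)
            with (Wcomp h psi f z + - Wcomp h psi F z)%C by (unfold Wcomp, F; ring).
          apply rpow_Cmod_add_le. lra.
      - apply Rmult_le_compat_l; [lra|].
        apply Rplus_le_compat; [apply Mp_le_norm; auto|].
        eapply Rle_trans; [apply Mp_le_norm; auto | exact HWFp]. }
    assert (E : K * (rpow M' p + 1) * e = eps) by (unfold e; field; split; lra).
    assert (K * (rpow M' p * e) <= eps) by (rewrite <- E; nra).
    replace (A * (rpow 2 p * (rpow nW p + rpow M' p * e)))
      with (K * rpow nW p + K * (rpow M' p * e)) by (unfold K; ring).
    lra.
Qed.
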